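(* Let $X$ be a coalgebra over a field $k$, let $s$ be a left non-degenerate coalgebra endomorphism of $X\otimes X$ and let $\mathcal{X}=(X,\cdot,\mathbin{:})$ be the left regular $q$-magma coalgebra associated with $s$. The map $s$ is a set-theoretic type solution of the braid equation if and only if $\mathcal{X}$ is a $q$-cycle coalgebra.
   Context: All vector spaces, maps and tensor products are over $k$ (maps are linear); Sweedler notation $\Delta(x)=x_{(1)}\otimes x_{(2)}$ is used; $\epsilon$ is the counit; $X^2=X\otimes X$; $X^{\mathrm{cop}}$ is the opposite coalgebra; $X$ inside a tensor product of maps denotes $\mathrm{id}_X$. For $s\colon X^2\to X^2$ put ${}^xy:=(X\otimes\epsilon)s(x\otimes y)$, $x^y:=(\epsilon\otimes X)s(x\otimes y)$ and $G_s(x\otimes y):=x^{y_{(1)}}\otimes y_{(2)}$. A coalgebra morphism $s$ is left non-degenerate if $G_s$ is invertible. In that case the $q$-magma coalgebra associated with $s$ is $(X,\cdot,\mathbin{:})$ with $x\cdot y:=(X\otimes\epsilon)G_s^{-1}(x\otimes y)$ and $x\mathbin{:}y:={}^{y\cdot x_{(1)}}x_{(2)}$. A coalgebra endomorphism $s$ of $X^2$ is a set-theoretic type solution of the braid equation if $s_{12}s_{23}s_{12}=s_{23}s_{12}s_{23}$ on $X^{\otimes 3}$, where $s_{12}=s\otimes X$, $s_{23}=X\otimes s$. A triple $(X,\cdot,\mathbin{:})$, with linear maps $\cdot,\mathbin{:}\colon X^2\to X$ such that $\epsilon(x\cdot y)=\epsilon(x\mathbin{:}y)=\epsilon(x)\epsilon(y)$,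 is a $q$-magma coalgebra if $X\otimes X^{\mathrm{cop}}\to X^{\mathrm{cop}}\otimes X$, $x\otimes y\mapsto y_{(1)}\mathbin{:}x_{(2)}\otimes x_{(1)}\cdot y_{(2)}$, is a coalgebra morphism; it is left regular if $x\otimes y\mapsto x\cdot y_{(1)}\otimes y_{(2)}$ is invertible on $X^2$. (The triple associated with a left non-degenerate $s$ is always a left regular $q$-magma coalgebra.) A $q$-cycle coalgebra is a left regular $q$-magma coalgebra such that for all $x,y,z\in X$: (1) $(x\cdot y_{(1)})\cdot(z\mathbin{:}y_{(2)})=(x\cdot z_{(2)})\cdot(y\cdot z_{(1)})$, (2) $(x\cdot y_{(1)})\mathbin{:}(z\cdot y_{(2)})=(x\mathbin{:}z_{(2)})\cdot(y\mathbin{:}z_{(1)})$, (3) $(x\mathbin{:}y_{(1)})\mathbin{:}(z\mathbin{:}y_{(2)})=(x\mathbin{:}z_{(2)})\mathbin{:}(y\cdot z_{(1)})$. *)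

(* Defs.v *)
From HB Require Import structures.
From mathcomp Require Import all_boot all_order all_algebra.
From mathcomp Require Import boolp.

Set Implicit Arguments.
Unset Strict Implicit.
Unset Printing Implicit Defensive.

Import GRing.Theory.
Local Open Scope ring_scope.
Local Open Scope quotient_scope.

Reserved Notation "U ⊗ V" (at level 40, left associativity).
Reserved Notation "u \ox v" (at level 40, left associativity).

Section Tensor.
Context {k : fieldType}.
Variables U V : lmodType k.

(* A list [:: (u1, v1); ...; (un, vn)] stands for the formal sum of the
   u_i ⊗ v_i; tensor_rel is the congruence generated by bilinearity. *)
Inductive tensor_rel : seq (U * V) -> seq (U * V) -> Prop :=
| tensor_refl s : tensor_rel s s
| tensor_sym s t : tensor_rel s t -> tensor_rel t s
| tensor_trans s t r : tensor_rel s t -> tensor_rel t r -> tensor_rel s r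
| tensor_cat s s' t t' :
    tensor_rel s s' -> tensor_rel t t' -> tensor_rel (s ++ t) (s' ++ t')
| tensor_catC s t : tensor_rel (s ++ t) (t ++ s)
| tensor_zero v : tensor_rel [:: (0, v)] [::]
| tensor_addl u u' v : tensor_rel [:: (u + u', v)] [:: (u, v); (u', v)]
| tensor_addr u v v' : tensor_rel [:: (u, v + v')] [:: (u, v); (u, v')]
| tensor_scale a u v : tensor_rel [:: (a *: u, v)] [:: (u, a *: v)].

Definition tensor_relb : rel (seq (U * V)) := fun s t => `[< tensor_rel s t >].

Fact tensor_relb_refl : reflexive tensor_relb.
Proof. by move=> s; apply/asboolP/tensor_refl. Qed.

Fact tensor_relb_sym : symmetric tensor_relb.
Proof. by move=> s t; apply/asboolP/asboolP => /tensor_sym. Qed.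

Fact tensor_relb_trans : transitive tensor_relb.
Proof.
move=> t s r /asboolP st /asboolP tr; apply/asboolP; exact: tensor_trans tr.
Qed.

Canonical tensor_equiv :=
  EquivRel tensor_relb tensor_relb_refl tensor_relb_sym tensor_relb_trans.

Definition tensor : Type := {eq_quot tensor_equiv}.
HB.instance Definition _ := EqQuotient.on tensor.
HB.instance Definition _ := Choice.on tensor.

Definition tens (u : U) (v : V) : tensor := \pi_tensor [:: (u, v)].

Lemma tensor_eqP s t : tensor_rel s t <-> \pi_tensor s = \pi_tensor t.
Proof.
split=> [st|/eqP]; first by apply/eqP; rewrite eqmodE; apply/asboolP.
by rewrite eqmodE => /asboolP.
Qed.

Lemma tensor_repr s : tensor_rel (repr (\pi_tensor s)) s.
Proof. by apply/tensor_eqP; rewrite reprK. Qed.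

Lemma tensor_piW (P : tensor -> Prop) :
  (forall s, P (\pi_tensor s)) -> forall x, P x.
Proof. by move=> Ppi x; rewrite -[x]reprK. Qed.

Definition tensor_add (x y : tensor) : tensor := \pi_tensor (repr x ++ repr y).
Definition tensor_smul (a : k) (x : tensor) : tensor :=
  \pi_tensor [seq (a *: p.1, p.2) | p <- repr x].

Lemma tensor_addE s t :
  tensor_add (\pi_tensor s) (\pi_tensor t) = \pi_tensor (s ++ t).
Proof. by apply/tensor_eqP; apply: tensor_cat; apply: tensor_repr. Qed.

Lemma tensor_smulE a s :
  tensor_smul a (\pi_tensor s) = \pi_tensor [seq (a *: p.1, p.2) | p <- s].
Proof.
suff rel_map s1 s2 : tensor_rel s1 s2 ->
    tensor_rel [seq (a *: p.1, p.2) | p <- s1] [seq (a *: p.1, p.2) | p <- s2].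
  by apply/tensor_eqP/rel_map/tensor_repr.
elim=> {s1 s2} /=.
- by move=> s1; apply: tensor_refl.
- by move=> s1 t1 _ st; apply: tensor_sym st.
- by move=> s1 t1 r _ st _ tr; apply: tensor_trans tr.
- by move=> s1 s2 t1 t2 _ ss _ tt; rewrite !map_cat; apply: tensor_cat.
- by move=> s1 t1; rewrite !map_cat; apply: tensor_catC.
- by move=> v; rewrite scaler0; apply: tensor_zero.
- by move=> u u' v; rewrite scalerDr; apply: tensor_addl.
- by move=> u v v'; apply: tensor_addr.
- by move=> b u v; rewrite scalerA mulrC -scalerA; apply: tensor_scale.
Qed.

Let tensor_opp (x : tensor) := tensor_smul (-1) x.

Fact tensor_addA : associative tensor_add.
Proof.
move=> x y z; elim/tensor_piW: x => s; elim/tensor_piW: y => t; elim/tensor_piW: z => r.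
by rewrite !tensor_addE catA.
Qed.

Fact tensor_addC : commutative tensor_add.
Proof.
move=> x y; elim/tensor_piW: x => s; elim/tensor_piW: y => t; rewrite !tensor_addE.
by apply/tensor_eqP/tensor_catC.
Qed.

Fact tensor_add0 : left_id (\pi_tensor [::]) tensor_add.
Proof. by move=> x; elim/tensor_piW: x => s; rewrite tensor_addE. Qed.

Fact tensor_smulDl x : {morph tensor_smul^~ x : a b / a + b >-> tensor_add a b}.
Proof.
move=> a b; elim/tensor_piW: x => s; rewrite !tensor_smulE tensor_addE.
apply/tensor_eqP; elim: s => [|[u v] s IH] /=; first exact: tensor_refl.
rewrite scalerDl -cat1s.
apply: tensor_trans (tensor_cat (tensor_addl _ _ _) IH) _.
set p := (a *: u, v); set q := (b *: u, v).
set sa := map _ _; set sb := map _ _.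
rewrite -[p :: sa ++ _]/([:: p] ++ (sa ++ [:: q] ++ sb)).
rewrite -[[:: p; q] ++ _]/([:: p] ++ ([:: q] ++ sa ++ sb)).
apply: tensor_cat; first exact: tensor_refl.
by rewrite !catA; apply: tensor_cat; [apply: tensor_catC | apply: tensor_refl].
Qed.

Fact tensor_smul0 x : tensor_smul 0 x = \pi_tensor [::].
Proof.
elim/tensor_piW: x => s; rewrite tensor_smulE; apply/tensor_eqP.
elim: s => [|[u v] s IH] /=; first exact: tensor_refl.
by rewrite scale0r -cat1s; apply: tensor_cat (tensor_zero v) IH.
Qed.

Fact tensor_smul1 : left_id 1 tensor_smul.
Proof.
move=> x; elim/tensor_piW: x => s; rewrite tensor_smulE; congr (\pi _).
by rewrite -[RHS]map_id; apply: eq_map => -[u v] /=; rewrite scale1r.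
Qed.

Fact tensor_addN : left_inverse (\pi_tensor [::]) tensor_opp tensor_add.
Proof.
by move=> x; rewrite -{2}[x]tensor_smul1 -tensor_smulDl addNr tensor_smul0.
Qed.

HB.instance Definition _ :=
  GRing.isZmodule.Build tensor tensor_addA tensor_addC tensor_add0 tensor_addN.

Fact tensor_smulA a b x :
  tensor_smul a (tensor_smul b x) = tensor_smul (a * b) x.
Proof.
elim/tensor_piW: x => s; rewrite !tensor_smulE -map_comp; congr (\pi _).
by apply: eq_map => -[u v] /=; rewrite scalerA.
Qed.

Fact tensor_smulDr : right_distributive tensor_smul +%R.
Proof.
move=> a x y; elim/tensor_piW: x => s; elim/tensor_piW: y => t.
by rewrite /+%R /= tensor_addE !tensor_smulE tensor_addE map_cat.
Qed.

HB.instance Definition _ := GRing.Zmodule_isLmodule.Build k tensor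
  tensor_smulA tensor_smul1 tensor_smulDr tensor_smulDl.

Lemma tensDl u u' v : tens (u + u') v = tens u v + tens u' v.
Proof.
by rewrite /+%R /= tensor_addE; apply/tensor_eqP/tensor_addl.
Qed.

Lemma tensDr u v v' : tens u (v + v') = tens u v + tens u v'.
Proof.
by rewrite [RHS]/+%R /= tensor_addE; apply/tensor_eqP/tensor_addr.
Qed.

Lemma tensZl a u v : tens (a *: u) v = a *: tens u v.
Proof. by rewrite [RHS]/*:%R /= tensor_smulE. Qed.

Lemma tensZr a u v : tens u (a *: v) = a *: tens u v.
Proof. by rewrite -tensZl; apply/tensor_eqP/tensor_sym/tensor_scale. Qed.

Lemma tens0l v : tens 0 v = 0.
Proof. by rewrite -(scale0r 0) tensZl scale0r. Qed.

Lemma tens0r u : tens u 0 = 0.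
Proof. by rewrite -(scale0r 0) tensZr scale0r. Qed.

Lemma tensor_sumE s : \pi_tensor s = \sum_(p <- s) tens p.1 p.2.
Proof.
elim: s => [|[u v] s IH]; first by rewrite big_nil.
by rewrite big_cons -IH /= /+%R /= tensor_addE.
Qed.

Lemma tensorE (t : tensor) : t = \sum_(p <- repr t) tens p.1 p.2.
Proof. by rewrite -tensor_sumE reprK. Qed.

Lemma tensor_ind (P : tensor -> Prop) :
  P 0 -> (forall u v t, P t -> P (tens u v + t)) -> forall t, P t.
Proof.
move=> P0 PD t; rewrite [t]tensorE.
by elim: (repr t) => [|[u v] s IH]; rewrite ?big_nil ?big_cons //; apply: PD.
Qed.

Lemma tensor_ext (W : lmodType k) (f g : {linear tensor -> W}) :
  (forall u v, f (tens u v) = g (tens u v)) -> f =1 g.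
Proof.
move=> fg; elim/tensor_ind=> [|u v t IH]; first by rewrite !linear0.
by rewrite !linearD fg IH.
Qed.

Definition bilin (W : lmodType k) (f : U -> V -> W) : Prop :=
  (forall v, linear (f^~ v)) /\ (forall u, linear (f u)).

Section Lift.
Variables (W : lmodType k) (f : U -> V -> W).

Definition tlift_fun (fb : bilin f) (t : tensor) : W :=
  \sum_(p <- repr t) f p.1 p.2.

Lemma bilin_sum (fb : bilin f) s t : tensor_rel s t ->
  \sum_(p <- s) f p.1 p.2 = \sum_(p <- t) f p.1 p.2.
Proof.
case: fb => fl fr.
have fDl u u' v : f (u + u') v = f u v + f u' v.
  by have := fl v 1 u u'; rewrite !scale1r.
have f0 v : f 0 v = 0 by apply: (addIr (f 0 v)); rewrite -fDl !add0r.
have fDr u v v' : f u (v + v') = f u v + f u v'.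
  by have := fr u 1 v v'; rewrite !scale1r.
have f0' u : f u 0 = 0 by apply: (addIr (f u 0)); rewrite -fDr !add0r.
have fZl a u v : f (a *: u) v = a *: f u v.
  by have := fl v a u 0; rewrite !addr0 f0 addr0.
have fZr a u v : f u (a *: v) = a *: f u v.
  by have := fr u a v 0; rewrite !addr0 f0' addr0.
elim=> {s t} //.
- by move=> s t r _ -> _ ->.
- by move=> s s' t t' _ e _ e'; rewrite !big_cat /= e e'.
- by move=> s t; rewrite !big_cat; exact: addrC.
- by move=> v; rewrite big_seq1 big_nil /=.
- by move=> u u' v; rewrite big_seq1 big_cons big_seq1 /=.
- by move=> u v v'; rewrite big_seq1 big_cons big_seq1 /=.
- by move=> a u v; rewrite !big_seq1 /= fZl fZr.
Qed.

Fact tlift_subproof (fb : bilin f) : linear (tlift_fun fb).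
Proof.
move=> a x y; have fP := bilin_sum fb; have [fl _] := fb.
have fZl b u v : f (b *: u) v = b *: f u v.
  have := fP [:: (0, v)] [::] (tensor_zero _); rewrite big_seq1 big_nil /= => f0.
  by have := fl v b u 0; rewrite !addr0 f0 addr0.
rewrite /tlift_fun; elim/tensor_piW: x => s; elim/tensor_piW: y => t.
rewrite [a *: _]/*:%R /= tensor_smulE /+%R /= tensor_addE.
rewrite !(fP _ _ (tensor_repr _)) big_cat big_map scaler_sumr /=.
by congr (_ + _); apply: eq_bigr => p _; rewrite fZl.
Qed.

HB.instance Definition _ (fb : bilin f) :=
  GRing.isLinear.Build k tensor W *:%R (tlift_fun fb) (tlift_subproof fb).

Definition tlift (fb : bilin f) : {linear tensor -> W} := tlift_fun fb.

Lemma tliftE (fb : bilin f) u v : tlift fb (tens u v) = f u v.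
Proof.
by rewrite /= /tlift_fun (bilin_sum fb (tensor_repr _)) big_seq1.
Qed.

End Lift.
End Tensor.

Arguments tlift {k U V W f} fb.

(* U ⊗ V denotes the lmodType itself rather than its carrier, which keeps
   reverse coercions out of the types of linear maps. *)
Notation "U ⊗ V" := (Defs_tensor__canonical__GRing_Lmodule U V).
(* The field k as a vector space over itself. *)
Notation "k ^⊙" := (GRing.GRing_regular__canonical__GRing_Lmodule k)
  (at level 2, format "k ^⊙").
Notation "u \ox v" := (tens u v) : ring_scope.

Reserved Notation "f ∘ g" (at level 40, left associativity).

Section TensorMaps.
Context {k : fieldType}.

Fact tmap_bilin (U V U' V' : lmodType k)
    (f : {linear U -> U'}) (g : {linear V -> V'}) :
  bilin (fun u v => f u \ox g v).
Proof.
by split=> [v a u u'|u a v v']; rewrite linearP ?(tensDl, tensDr) ?(tensZl, tensZr).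
Qed.

Definition tmap (U V U' V' : lmodType k)
    (f : {linear U -> U'}) (g : {linear V -> V'}) :
  {linear U ⊗ V -> U' ⊗ V'} := tlift (tmap_bilin f g).

Lemma tmapE (U V U' V' : lmodType k)
    (f : {linear U -> U'}) (g : {linear V -> V'}) u v :
  tmap f g (u \ox v) = f u \ox g v.
Proof. exact: tliftE. Qed.

Definition idl (U : lmodType k) : {linear U -> U} := idfun.

Lemma idlE (U : lmodType k) (u : U) : idl U u = u.
Proof. by []. Qed.

Definition lcomp (U V W : lmodType k)
  (f : {linear V -> W}) (g : {linear U -> V}) : {linear U -> W} := f \o g.

Local Notation "f ∘ g" := (lcomp f g).

Lemma lcompE (U V W : lmodType k)
    (f : {linear V -> W}) (g : {linear U -> V}) u :
  (f ∘ g) u = f (g u).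
Proof. by []. Qed.

Fact tflip_bilin (U V : lmodType k) : bilin (fun (u : U) (v : V) => v \ox u).
Proof.
by split=> [v a u u'|u a v v']; rewrite ?(tensDl, tensDr) ?(tensZl, tensZr).
Qed.

Definition tflip (U V : lmodType k) : {linear U ⊗ V -> V ⊗ U} :=
  tlift (@tflip_bilin U V).

Lemma tflipE (U V : lmodType k) (u : U) (v : V) : tflip U V (u \ox v) = v \ox u.
Proof. exact: tliftE. Qed.

Definition tensl_fun (U V : lmodType k) (u : U) (v : V) : U ⊗ V := u \ox v.

Fact tensl_linear (U V : lmodType k) (u : U) : linear (@tensl_fun U V u).
Proof. by move=> a v v'; rewrite /tensl_fun tensDr tensZr. Qed.

HB.instance Definition _ (U V : lmodType k) (u : U) :=
  GRing.isLinear.Build k V (U ⊗ V) *:%R (tensl_fun u) (@tensl_linear U V u).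

Definition tensl (U V : lmodType k) (u : U) : {linear V -> U ⊗ V} :=
  tensl_fun u.

Definition tensr_fun (U V : lmodType k) (v : V) (u : U) : U ⊗ V := u \ox v.

Fact tensr_linear (U V : lmodType k) (v : V) : linear (@tensr_fun U V v).
Proof. by move=> a u u'; rewrite /tensr_fun tensDl tensZl. Qed.

HB.instance Definition _ (U V : lmodType k) (v : V) :=
  GRing.isLinear.Build k U (U ⊗ V) *:%R (tensr_fun v) (@tensr_linear U V v).

Definition tensr (U V : lmodType k) (v : V) : {linear U -> U ⊗ V} :=
  tensr_fun v.

Lemma tensrE (U V : lmodType k) (u : U) (v : V) : tensr U v u = u \ox v.
Proof. by []. Qed.

Lemma tenslE (U V : lmodType k) (u : U) (v : V) : tensl V u v = u \ox v.
Proof. by []. Qed.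

Fact tassoc_bilin (U V W : lmodType k) :
  bilin (fun (t : U ⊗ V) (w : W) => tmap (idl U) (tensr V w) t).
Proof.
split=> [w a t t'|t a w w']; first by rewrite linearP.
elim/(@tensor_ind k U V): t => [|u v t IH]; first by rewrite !linear0 addr0.
rewrite !linearD IH !tmapE !(tensrE, tenslE) addrACA; congr (_ + _).
by rewrite !(tensDr, tensZr).
Qed.

Definition tassoc (U V W : lmodType k) :
    {linear (U ⊗ V) ⊗ W -> U ⊗ (V ⊗ W)} := tlift (tassoc_bilin U V W).

Lemma tassocE (U V W : lmodType k) (u : U) (v : V) (w : W) :
  tassoc U V W ((u \ox v) \ox w) = u \ox (v \ox w).
Proof. by rewrite tliftE tmapE. Qed.

Fact tassocV_bilin (U V W : lmodType k) :
  bilin (fun (u : U) (t : V ⊗ W) => tmap (tensl V u) (idl W) t).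
Proof.
split=> [t a u u'|u a t t']; last by rewrite linearP.
elim/(@tensor_ind k V W): t => [|v w t IH]; first by rewrite !linear0 addr0.
rewrite !linearD IH !tmapE !(tensrE, tenslE) addrACA; congr (_ + _).
by rewrite !(tensDl, tensZl).
Qed.

Definition tassocV (U V W : lmodType k) :
  {linear U ⊗ (V ⊗ W) -> (U ⊗ V) ⊗ W} := tlift (tassocV_bilin U V W).

Lemma tassocVE (U V W : lmodType k) (u : U) (v : V) (w : W) :
  tassocV U V W (u \ox (v \ox w)) = (u \ox v) \ox w.
Proof. by rewrite tliftE tmapE. Qed.

Definition tmid (A B C D : lmodType k) :
    {linear (A ⊗ B) ⊗ (C ⊗ D) -> (A ⊗ C) ⊗ (B ⊗ D)} :=
  tassocV A C (B ⊗ D)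
  ∘ tmap (idl A)
       (tassoc C B D ∘ tmap (tflip B C) (idl D) ∘ tassocV B C D)
  ∘ tassoc A B (C ⊗ D).

Lemma tmidE (A B C D : lmodType k) (a : A) (b : B) (c : C) (d : D) :
  tmid A B C D ((a \ox b) \ox (c \ox d)) = (a \ox c) \ox (b \ox d).
Proof.
by rewrite !lcompE tassocE tmapE !lcompE tassocVE tmapE tflipE tassocE tassocVE.
Qed.

Fact tunitl_bilin (U : lmodType k) : bilin (fun (a : k^⊙) (u : U) => a *: u).
Proof.
split=> [u b a a'|a b u u']; first by rewrite scalerDl scalerA.
by rewrite scalerDr !scalerA mulrC.
Qed.

Definition tunitl (U : lmodType k) : {linear k^⊙ ⊗ U -> U} :=
  tlift (tunitl_bilin U).

Lemma tunitlE (U : lmodType k) (a : k^⊙) (u : U) : tunitl U (a \ox u) = a *: u.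
Proof. exact: tliftE. Qed.

Definition tunitr (U : lmodType k) : {linear U ⊗ k^⊙ -> U} :=
  tunitl U ∘ tflip U k^⊙.

Lemma tunitrE (U : lmodType k) (a : k^⊙) (u : U) : tunitr U (u \ox a) = a *: u.
Proof. by rewrite lcompE tflipE tunitlE. Qed.

End TensorMaps.

Notation "f ∘ g" := (lcomp f g).

Record coalgType (k : fieldType) := Coalgebra {
  coalg_sort :> lmodType k;
  comul : {linear coalg_sort -> coalg_sort ⊗ coalg_sort};
  counit : {linear coalg_sort -> k^⊙};
  coassoc : forall x,
    tassoc _ _ _ (tmap comul (idl _) (comul x)) =
    tmap (idl _) comul (comul x);
  counitl : forall x, tunitl _ (tmap counit (idl _) (comul x)) = x;
  counitr : forall x, tunitr _ (tmap (idl _) counit (comul x)) = x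
}.
Arguments comul {k c}.
Arguments counit {k c}.
Arguments coassoc {k c} x.
Arguments counitl {k c} x.
Arguments counitr {k c} x.

Definition sweedler (k : fieldType) (C : coalgType k) (W : lmodType k)
    (x : C) (F : C -> C -> W) : W :=
  \sum_(p <- repr (comul x)) F p.1 p.2.

(* Sweedler notation: x1 and x2 range over the terms of a fixed representation
   of comul x; by sweedlerE the sum does not depend on the representation as
   soon as E is bilinear in x1 and x2. *)
Notation "\sw_ ( x1 , x2 <- x ) E" := (sweedler x (fun x1 x2 => E))
  (at level 41, x1 name, x2 name, E at level 41,
   format "\sw_ ( x1 ,  x2  <-  x )  E") : ring_scope.

Lemma sweedlerE (k : fieldType) (C : coalgType k) (W : lmodType k) (x : C)
    (F : C -> C -> W) (s : seq (C * C)) :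
    bilin F -> comul x = \sum_(p <- s) p.1 \ox p.2 ->
  \sw_(x1, x2 <- x) F x1 x2 = \sum_(p <- s) F p.1 p.2.
Proof.
move=> Fb xE; apply: (bilin_sum Fb).
by apply/tensor_eqP; rewrite reprK xE tensor_sumE.
Qed.

Lemma sweedler_lin (k : fieldType) (C : coalgType k) (W : lmodType k) (x : C)
    (f : {linear C ⊗ C -> W}) :
  f (comul x) = \sw_(x1, x2 <- x) f (x1 \ox x2).
Proof. by rewrite [comul x in LHS]tensorE linear_sum. Qed.

Section TensorCoalgebra.
Context {k : fieldType} (A B : coalgType k).

Definition tensor_comul : {linear A ⊗ B -> (A ⊗ B) ⊗ (A ⊗ B)} :=
  tmid A A B B ∘ tmap comul comul.

Definition tensor_counit : {linear A ⊗ B -> k^⊙} :=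
  tunitl k^⊙ ∘ tmap counit counit.

Lemma tensor_comulE a b :
  tensor_comul (a \ox b) = tmid A A B B (comul a \ox comul b).
Proof. by rewrite lcompE tmapE. Qed.

Lemma tensor_counitE a b : tensor_counit (a \ox b) = counit a * counit b.
Proof. by rewrite lcompE tmapE tunitlE. Qed.

Fact tensor_coassoc x :
  tassoc _ _ _ (tmap tensor_comul (idl _) (tensor_comul x)) =
  tmap (idl _) tensor_comul (tensor_comul x).
Proof.
pose M : {linear (A ⊗ (A ⊗ A)) ⊗ (B ⊗ (B ⊗ B)) -> (A ⊗ B) ⊗ ((A ⊗ B) ⊗ (A ⊗ B))} :=
  tmap (idl _) (tmid A A B B) ∘ tmid A (A ⊗ A) B (B ⊗ B).
have eL t u : tassoc _ _ _ (tmap tensor_comul (idl _) (tmid A A B B (t \ox u))) =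
    M (tassoc _ _ _ (tmap comul (idl _) t) \ox tassoc _ _ _ (tmap comul (idl _) u)).
  elim/(@tensor_ind k A A): t => [|a1 a2 t IH]; first by rewrite !(linear0, tens0l).
  rewrite !(linearD, tensDl) IH; congr (_ + _) => {t IH}.
  elim/(@tensor_ind k B B): u => [|b1 b2 u IH]; first by rewrite !(linear0, tens0r).
  rewrite !(linearD, tensDr) IH; congr (_ + _) => {u IH}.
  rewrite tmidE !tmapE !idlE tensor_comulE.
  move: (comul a1) => t; elim/(@tensor_ind k A A): t => [|a3 a4 t IH].
    by rewrite !(linear0, tens0l).
  rewrite !(linearD, tensDl) IH; congr (_ + _) => {t IH}.
  move: (comul b1) => t; elim/(@tensor_ind k B B): t => [|b3 b4 t IH].
    by rewrite !(linear0, tens0r, tens0l).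
  rewrite !(linearD, tensDr, tensDl) IH; congr (_ + _) => {t IH}.
  by rewrite /M lcompE !(tmidE, tassocE, tmapE, idlE).
have eR t u : tmap (idl _) tensor_comul (tmid A A B B (t \ox u)) =
    M (tmap (idl _) comul t \ox tmap (idl _) comul u).
  elim/(@tensor_ind k A A): t => [|a1 a2 t IH]; first by rewrite !(linear0, tens0l).
  rewrite !(linearD, tensDl) IH; congr (_ + _) => {t IH}.
  elim/(@tensor_ind k B B): u => [|b1 b2 u IH]; first by rewrite !(linear0, tens0r).
  rewrite !(linearD, tensDr) IH; congr (_ + _) => {u IH}.
  by rewrite /M lcompE !(tmidE, tmapE, idlE) tensor_comulE.
elim/(@tensor_ind k A B): x => [|a b x IH]; first by rewrite !linear0.
by rewrite !linearD IH tensor_comulE eL eR !coassoc.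
Qed.

Fact tensor_counitl x :
  tunitl _ (tmap tensor_counit (idl _) (tensor_comul x)) = x.
Proof.
have e t u : tunitl _ (tmap tensor_counit (idl _) (tmid A A B B (t \ox u))) =
    tunitl A (tmap counit (idl _) t) \ox tunitl B (tmap counit (idl _) u).
  elim/(@tensor_ind k A A): t => [|a1 a2 t IH]; first by rewrite !(linear0, tens0l).
  rewrite !(linearD, tensDl) IH; congr (_ + _) => {t IH}.
  elim/(@tensor_ind k B B): u => [|b1 b2 u IH]; first by rewrite !(linear0, tens0r).
  rewrite !(linearD, tensDr) IH; congr (_ + _) => {u IH}.
  by rewrite tmidE !tmapE !idlE !tunitlE tensor_counitE tensZl tensZr scalerA.
elim/(@tensor_ind k A B): x => [|a b x IH]; first by rewrite !linear0.
by rewrite !linearD IH tensor_comulE e !counitl.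
Qed.

Fact tensor_counitr x :
  tunitr _ (tmap (idl _) tensor_counit (tensor_comul x)) = x.
Proof.
have e t u : tunitr _ (tmap (idl _) tensor_counit (tmid A A B B (t \ox u))) =
    tunitr A (tmap (idl _) counit t) \ox tunitr B (tmap (idl _) counit u).
  elim/(@tensor_ind k A A): t => [|a1 a2 t IH]; first by rewrite !(linear0, tens0l).
  rewrite !(linearD, tensDl) IH; congr (_ + _) => {t IH}.
  elim/(@tensor_ind k B B): u => [|b1 b2 u IH]; first by rewrite !(linear0, tens0r).
  rewrite !(linearD, tensDr) IH; congr (_ + _) => {u IH}.
  by rewrite tmidE !tmapE !idlE !tunitrE tensor_counitE tensZl tensZr scalerA.
elim/(@tensor_ind k A B): x => [|a b x IH]; first by rewrite !linear0.
by rewrite !linearD IH tensor_comulE e !counitr.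
Qed.

Canonical tensor_coalg : coalgType k :=
  Coalgebra tensor_coassoc tensor_counitl tensor_counitr.

End TensorCoalgebra.

Section Cop.
Context {k : fieldType} (C : coalgType k).

Definition cop : lmodType k := C.

Definition cop_comul : {linear C -> C ⊗ C} := tflip C C ∘ comul.

Fact cop_coassoc x :
  tassoc _ _ _ (tmap cop_comul (idl _) (cop_comul x)) =
  tmap (idl _) cop_comul (cop_comul x).
Proof.
pose M : {linear C ⊗ (C ⊗ C) -> C ⊗ (C ⊗ C)} :=
  tassoc C C C ∘ tflip C (C ⊗ C) ∘ tmap (idl C) (tflip C C).
have eL t : tassoc _ _ _ (tmap cop_comul (idl _) (tflip C C t)) =
    M (tmap (idl _) comul t).
  elim/(@tensor_ind k C C): t => [|a1 a2 t IH]; first by rewrite !linear0.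
  rewrite !linearD IH; congr (_ + _) => {t IH}.
  rewrite tflipE !tmapE !idlE lcompE.
  move: (comul a2) => t; elim/(@tensor_ind k C C): t => [|a3 a4 t IH].
    by rewrite !(linear0, tens0l, tens0r).
  rewrite !(linearD, tensDl, tensDr) IH; congr (_ + _) => {t IH}.
  by rewrite /M !lcompE !(tflipE, tassocE, tmapE, idlE).
have eR t : tmap (idl _) cop_comul (tflip C C t) =
    M (tassoc _ _ _ (tmap comul (idl _) t)).
  elim/(@tensor_ind k C C): t => [|a1 a2 t IH]; first by rewrite !linear0.
  rewrite !linearD IH; congr (_ + _) => {t IH}.
  rewrite tflipE !tmapE !idlE lcompE.
  move: (comul a1) => t; elim/(@tensor_ind k C C): t => [|a3 a4 t IH].
    by rewrite !(linear0, tens0l, tens0r).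
  rewrite !(linearD, tensDl, tensDr) IH; congr (_ + _) => {t IH}.
  by rewrite /M !lcompE !(tflipE, tassocE, tmapE, idlE).
by rewrite [cop_comul x]lcompE eL eR coassoc.
Qed.

Fact cop_counitl x : tunitl C (tmap counit (idl _) (cop_comul x)) = x.
Proof.
rewrite -[RHS]counitr [cop_comul x]lcompE.
move: (comul x) => t; elim/(@tensor_ind k C C): t => [|a b t IH]; first by rewrite !linear0.
by rewrite !linearD IH tflipE !tmapE tunitlE tunitrE.
Qed.

Fact cop_counitr x : tunitr C (tmap (idl _) counit (cop_comul x)) = x.
Proof.
rewrite -[RHS]counitl [cop_comul x]lcompE.
move: (comul x) => t; elim/(@tensor_ind k C C): t => [|a b t IH]; first by rewrite !linear0.
by rewrite !linearD IH tflipE !tmapE tunitlE tunitrE.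
Qed.

Canonical cop_coalg : coalgType k :=
  @Coalgebra k cop cop_comul counit cop_coassoc cop_counitl cop_counitr.

End Cop.

Definition is_coalg_morphism (k : fieldType) (A B : coalgType k)
    (f : {linear A -> B}) : Prop :=
  (forall x, comul (f x) = tmap f f (comul x)) /\
  (forall x, counit (f x) = counit x).

Section LinearInverse.
Context {k : fieldType} (U V : lmodType k) (f : {linear U -> V}).

Fact bijective_onto (fb : bijective f) v : exists u, f u == v.
Proof. by case: fb => g _ fK; exists (g v); rewrite fK. Qed.

Definition lin_inv_fun (fb : bijective f) (v : V) : U :=
  xchoose (bijective_onto fb v).

Lemma lin_inv_funK (fb : bijective f) : cancel (lin_inv_fun fb) f.
Proof. by move=> v; apply/eqP/(xchooseP (bijective_onto fb v)). Qed.

Fact lin_inv_linear (fb : bijective f) : linear (lin_inv_fun fb).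
Proof.
by move=> a v v'; apply: (bij_inj fb); rewrite linearP !lin_inv_funK.
Qed.

HB.instance Definition _ (fb : bijective f) :=
  GRing.isLinear.Build k V U *:%R (lin_inv_fun fb) (lin_inv_linear fb).

Definition lin_inv (fb : bijective f) : {linear V -> U} := lin_inv_fun fb.

Lemma lin_invK (fb : bijective f) : cancel (lin_inv fb) f.
Proof. exact: lin_inv_funK. Qed.

Lemma lin_invKV (fb : bijective f) : cancel f (lin_inv fb).
Proof. by move=> u; apply: (bij_inj fb); rewrite lin_invK. Qed.

End LinearInverse.

Section Braiding.
Context {k : fieldType} {X : coalgType k}.

(* m ⊗ id ∘ id ⊗ Δ, that is x ⊗ y ↦ m (x ⊗ y_(1)) ⊗ y_(2). *)
Definition twist (m : {linear X ⊗ X -> X}) : {linear X ⊗ X -> X ⊗ X} :=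
  tmap m (idl X) ∘ tassocV X X X ∘ tmap (idl X) comul.

Lemma twistE m x y : twist m (x \ox y) = \sw_(y1, y2 <- y) m (x \ox y1) \ox y2.
Proof.
pose f := tmap m (idl X) ∘ tassocV X X X ∘ tensl (X ⊗ X) x.
transitivity (f (comul y)); first by rewrite !lcompE tmapE.
rewrite sweedler_lin; apply: eq_bigr => p _.
by rewrite !lcompE tenslE tassocVE tmapE.
Qed.

Section Solution.
Variable s : {linear X ⊗ X -> X ⊗ X}.

(* s_left (x ⊗ y) and s_right (x ⊗ y) are ^x y and x^y respectively. *)
Definition s_left : {linear X ⊗ X -> X} := tunitr X ∘ tmap (idl X) counit ∘ s.
Definition s_right : {linear X ⊗ X -> X} := tunitl X ∘ tmap counit (idl X) ∘ s.

Definition Gmap : {linear X ⊗ X -> X ⊗ X} := twist s_right.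

Definition left_nondegenerate : Prop := bijective Gmap.

Definition s12 : {linear (X ⊗ X) ⊗ X -> (X ⊗ X) ⊗ X} := tmap s (idl X).
Definition s23 : {linear (X ⊗ X) ⊗ X -> (X ⊗ X) ⊗ X} :=
  tassocV X X X ∘ tmap (idl X) s ∘ tassoc X X X.

Definition set_theoretic_type_solution : Prop :=
  is_coalg_morphism s /\
  forall t, s12 (s23 (s12 t)) = s23 (s12 (s23 t)).

End Solution.
End Braiding.

Record qmagma (k : fieldType) (X : coalgType k) := QMagma {
  qdot : {linear X ⊗ X -> X};
  qcolon : {linear X ⊗ X -> X}
}.

Section QMagma.
Context {k : fieldType} {X : coalgType k}.

Section Predicates.
Variable q : qmagma X.

Local Notation "x ⋅ y" := (qdot q (x \ox y)) (at level 35, y at next level).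
Local Notation "x ∶ y" := (qcolon q (x \ox y)) (at level 35, y at next level).

Definition qmagma_map : {linear X ⊗ cop X -> cop X ⊗ X} :=
  tmap (qcolon q ∘ tflip X X) (qdot q) ∘ tmid X X X X
  ∘ tmap (tflip X X ∘ comul) comul.

Lemma qmagma_mapE (x y : X) :
  qmagma_map (x \ox y) =
  \sw_(x1, x2 <- x) \sw_(y1, y2 <- y) (y1 ∶ x2) \ox (x1 ⋅ y2).
Proof.
pose f : {linear (X ⊗ X) ⊗ (X ⊗ X) -> X ⊗ X} :=
  tmap (qcolon q ∘ tflip X X) (qdot q) ∘ tmid X X X X
  ∘ tmap (tflip X X) (idl (X ⊗ X)).
transitivity ((f ∘ tensr (X ⊗ X) (comul y)) (comul x)).
  by rewrite !lcompE tensrE !tmapE.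
rewrite sweedler_lin; apply: eq_bigr => p _.
transitivity ((f ∘ tensl (X ⊗ X) (p.1 \ox p.2)) (comul y)) => //.
rewrite sweedler_lin; apply: eq_bigr => r _.
by rewrite 3!lcompE tenslE tmapE tflipE idlE tmidE tmapE lcompE tflipE.
Qed.

Definition is_qmagma_coalgebra : Prop :=
  [/\ forall x y : X, counit (x ⋅ y) = counit x * counit y,
      forall x y : X, counit (x ∶ y) = counit x * counit y &
      is_coalg_morphism qmagma_map].

Definition left_regular : Prop := bijective (twist (qdot q)).

Definition is_qcycle_coalgebra : Prop :=
  [/\ is_qmagma_coalgebra,
      left_regular,
      forall x y z : X,
        \sw_(y1, y2 <- y) (x ⋅ y1) ⋅ (z ∶ y2) =
        \sw_(z1, z2 <- z) (x ⋅ z2) ⋅ (y ⋅ z1),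
      forall x y z : X,
        \sw_(y1, y2 <- y) (x ⋅ y1) ∶ (z ⋅ y2) =
        \sw_(z1, z2 <- z) (x ∶ z2) ⋅ (y ∶ z1) &
      forall x y z : X,
        \sw_(y1, y2 <- y) (x ∶ y1) ∶ (z ∶ y2) =
        \sw_(z1, z2 <- z) (x ∶ z2) ∶ (y ⋅ z1)].

End Predicates.

Section Associated.
Variables (s : {linear X ⊗ X -> X ⊗ X}) (nd : left_nondegenerate s).

Definition induced_dot : {linear X ⊗ X -> X} :=
  tunitr X ∘ tmap (idl X) counit ∘ lin_inv nd.

Definition induced_colon : {linear X ⊗ X -> X} :=
  s_left s ∘ twist induced_dot ∘ tflip X X.

Lemma induced_colonE x y :
  induced_colon (x \ox y) =
  \sw_(x1, x2 <- x) s_left s (induced_dot (y \ox x1) \ox x2).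
Proof.
by rewrite 2!lcompE tflipE twistE /sweedler linear_sum.
Qed.

Definition associated_qmagma : qmagma X := QMagma induced_dot induced_colon.

End Associated.
End QMagma.

(* Main.v *)
Require Import Defs.
From mathcomp Require Import all_boot all_order all_algebra.
From mathcomp Require Import ring.

Set Implicit Arguments.
Unset Strict Implicit.
Unset Printing Implicit Defensive.

Import GRing.Theory.
Local Open Scope ring_scope.

(** Write [x ▷ y] and [x ◁ y] for the two components of [s (x ⊗ y)]. Left
    non-degeneracy says that the right action [◁] is invertible in the
    convolution sense, and [⋅] is its convolution inverse:
    [(x ⋅ y_1) ◁ y_2 = ε(y) x = (x ◁ y_1) ⋅ y_2].

    The braid equation is an equality between coalgebra endomorphisms of
    [X ⊗ X ⊗ X], and a coalgebra morphism into a tensor product of coalgebras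
    is determined by its components; so it splits into three equations with
    values in [X] ([braid_components]). Each of them is matched with one of the
    identities of a q-cycle coalgebra.

    The basic tool is [conv_cancel]: a twisted action of a coalgebra can be
    moved to the other side of an equation as its convolution inverse. It
    first gives [comul_dot], the formula for [Δ(x ⋅ y)]; the twist in
    that formula is what makes
    [s (G^-1 (b ⊗ c)) = (c ∶ b_2) ⊗ b_1] hold ([s_lin_inv]) for non
    cocommutative coalgebras. That [X] with [⋅] and [∶] is a q-magma coalgebra
    follows from these two formulas.

    The last component of the braid equation says that the iterated action
    [(x ◁ y) ◁ z] of [X ⊗ X] on [X] is invariant under [s]. Equivalently its
    convolution inverse [(x ⋅ z) ⋅ y] is, and evaluating this at
    [y ⊗ z = G^-1 (b ⊗ c)] gives the first identity ([dot2_invariantP]).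

    For the other two components one substitutes the elements [triple a b c],
    which in the set-theoretic case are
    [((a ⋅ c) ⋅ (b ⋅ c)) ⊗ (b ⋅ c) ⊗ c] and which span [X ⊗ X ⊗ X].
    On them the first two factors of [s12] can be computed outright
    ([s12_triple]), while [s23] can be computed once the invariance above is
    known ([s23_triple]). The middle component then becomes
    [((b ⋅ c_1) ∶ (a_2 ⋅ c_2)) ◁ (c_3 ∶ a_1) = ε(c) (b ∶ a)], which is the
    second identity after moving [◁] to the other side ([middle_braidP]); and
    given the second identity the first component is literally the third
    identity ([left_braidP]). *)

(** * Multilinearity *)

Section Multilinear.
Context {k : fieldType}.
Implicit Types U V W : lmodType k.

(** Linearity as a constant with the map as an explicit argument, so that the
    tactic [mlin] below can match on the shape of the map. *)
Definition lin (U V : lmodType k) (f : U -> V) : Prop := linear f.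

Lemma lin_id U : lin (fun x : U => x). Proof. by []. Qed.

Lemma lin_comp U V W (f : {linear V -> W}) (g : U -> V) :
  lin g -> lin (fun x => f (g x)).
Proof. by move=> gl a x y; rewrite gl linearP. Qed.

Lemma lin0 U V (f : U -> V) : lin f -> f 0 = 0.
Proof. by move=> fl; have := fl (-1) 0 0; rewrite !scaleN1r !addNr. Qed.

Lemma linZ U V (f : U -> V) a u : lin f -> f (a *: u) = a *: f u.
Proof. by move=> fl; have := fl a u 0; rewrite !addr0 (lin0 fl) addr0. Qed.

Lemma lin_compf U V W (f : V -> W) (g : U -> V) :
  lin f -> lin g -> lin (fun x => f (g x)).
Proof. by move=> fl gl a x y; rewrite gl fl. Qed.

Lemma lin_tensl U V W (g : U -> V) (w : W) : lin g -> lin (fun x => g x \ox w).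
Proof. by move=> gl a x y; rewrite gl tensDl tensZl. Qed.

Lemma lin_tensr U V W (g : U -> V) (w : W) : lin g -> lin (fun x => w \ox g x).
Proof. by move=> gl a x y; rewrite gl tensDr tensZr. Qed.

Lemma lin_scalel U V (g : U -> k^⊙) (v : V) : lin g -> lin (fun x => g x *: v).
Proof. by move=> gl a x y; rewrite gl scalerDl scalerA. Qed.

Lemma lin_scaler U V (b : k) (g : U -> V) : lin g -> lin (fun x => b *: g x).
Proof. by move=> gl a x y; rewrite gl scalerDr !scalerA mulrC. Qed.

Lemma lin_sw U V (C : coalgType k) (c : C) (F : U -> C -> C -> V) :
  (forall c1 c2, lin (fun x => F x c1 c2)) -> lin (fun x => \sw_(c1, c2 <- c) F x c1 c2).
Proof.
move=> Fl a x y; rewrite /sweedler scaler_sumr -big_split /=.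
by apply: eq_bigr => p _; rewrite Fl.
Qed.

Lemma bilinI U V W (F : U -> V -> W) :
  (forall v, lin (fun u => F u v)) -> (forall u, lin (F u)) -> bilin F.
Proof. by split. Qed.

Lemma swE (C : coalgType k) W (c : C) (F : C -> C -> W) (Fb : bilin F) :
  \sw_(c1, c2 <- c) F c1 c2 = tlift Fb (comul c).
Proof. by rewrite sweedler_lin; apply: eq_bigr => p _; rewrite tliftE. Qed.

Lemma lin_sw_arg U W (C : coalgType k) (g : U -> C) (F : C -> C -> W) :
  bilin F -> lin g -> lin (fun x => \sw_(c1, c2 <- g x) F c1 c2).
Proof. by move=> Fb gl a x y; rewrite !(swE _ Fb) gl !linearP. Qed.

Lemma lin_sum U W (f : U -> W) I (r : seq I) (F : I -> U) : lin f ->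
  f (\sum_(i <- r) F i) = \sum_(i <- r) f (F i).
Proof.
move=> fl; elim: r => [|i r IH]; first by rewrite !big_nil lin0.
by rewrite !big_cons -IH -{1}[F i]scale1r fl scale1r.
Qed.

Lemma lin_comul (C : coalgType k) W (f : C ⊗ C -> W) (c : C) : lin f ->
  f (comul c) = \sw_(c1, c2 <- c) f (c1 \ox c2).
Proof. by move=> fl; rewrite [comul c in LHS]tensorE lin_sum. Qed.

End Multilinear.

(** Proves that an expression built from linear maps, tensors, scalings and
    Sweedler sums is linear in one variable, or bilinear in two. *)
Ltac mlin := cbv beta;
  lazymatch goal with
  | |- bilin _ => apply: bilinI; mlin
  | |- forall _, _ => intro; mlin
  | |- _ /\ _ => split; mlin
  | |- lin (fun x => x) => exact: lin_id
  | |- lin (tens _) => apply: lin_tensr; exact: lin_id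
  | |- lin (fun x => _ \ox _) =>
      first [apply: lin_tensl; mlin | apply: lin_tensr; mlin]
  | |- lin (fun x => _ *: _) =>
      first [apply: lin_scaler; mlin | apply: lin_scalel; mlin]
  | |- lin (fun x => sweedler _ _) =>
      first [apply: lin_sw; mlin | apply: lin_sw_arg; mlin]
  | Fl : lin ?F |- lin (fun x => ?F _) => apply: (lin_compf Fl); mlin
  | |- lin _ => first [assumption | exact: linearP | apply: lin_comp; mlin
      | match goal with Fl : _ |- _ => solve [apply: Fl] end
      | match goal with Fl : forall _, lin _ |- _ =>
          first [exact: Fl | apply: (lin_compf (Fl _)); mlin] end]
  end.

(** * Sweedler sums *)

Section SweedlerCalculus.
Context {k : fieldType}.
Implicit Types (C D : coalgType k) (W : lmodType k).

Lemma eq_sw C W (c : C) (F F' : C -> C -> W) :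
  (forall c1 c2, F c1 c2 = F' c1 c2) -> sweedler c F = sweedler c F'.
Proof. by move=> FF; apply: eq_bigr. Qed.

Lemma comulE C (c : C) : comul c = \sw_(c1, c2 <- c) c1 \ox c2.
Proof. exact: (lin_comul (f := id)). Qed.

Lemma scaler_sw C W (a : k) (c : C) (F : C -> C -> W) :
  a *: (\sw_(c1, c2 <- c) F c1 c2) = \sw_(c1, c2 <- c) a *: F c1 c2.
Proof. exact: scaler_sumr. Qed.

Lemma linear_sw C (V W : lmodType k) (f : V -> W) (c : C) F : lin f ->
  f (\sw_(c1, c2 <- c) F c1 c2) = \sw_(c1, c2 <- c) f (F c1 c2).
Proof. exact: lin_sum. Qed.

Lemma sw_exchange C D W (c : C) (d : D) (F : C -> C -> D -> D -> W) :
  \sw_(c1, c2 <- c) \sw_(d1, d2 <- d) F c1 c2 d1 d2 =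
  \sw_(d1, d2 <- d) \sw_(c1, c2 <- c) F c1 c2 d1 d2.
Proof. exact: exchange_big. Qed.

(** Multilinearity is essential: it is what makes both sides functions of the
    iterated coproduct rather than of chosen representatives. *)
Lemma sw_coassoc C W (c : C) (F : C -> C -> C -> W) :
  (forall v w, lin (fun u => F u v w)) ->
  (forall u w, lin (fun v => F u v w)) ->
  (forall u v, lin (fun w => F u v w)) ->
  \sw_(c1, c2 <- c) \sw_(c11, c12 <- c1) F c11 c12 c2 =
  \sw_(c1, c2 <- c) \sw_(c21, c22 <- c2) F c1 c21 c22.
Proof.
move=> F1 F2 F3.
have Fb u : bilin (F u) by split=> [v|v]; [apply: F2 | apply: F3].
have Gb : bilin (fun u (t : C ⊗ C) => tlift (Fb u) t).
  split=> [t a u u'|u a t t']; last by rewrite linearP.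
  elim/(@tensor_ind k C C): t => [|v w t IH]; first by rewrite !linear0 addr0.
  rewrite !linearD IH !tliftE F1 addrACA; congr (_ + _).
transitivity (tlift Gb (tassoc _ _ _ (tmap comul (idl _) (comul c)))).
  rewrite (lin_comul
    (f := fun t => tlift Gb (tassoc _ _ _ (tmap comul (idl _) t)))); last by mlin.
  apply: eq_bigr => p _; rewrite tmapE.
  rewrite (lin_comul
    (f := fun t => tlift Gb (tassoc _ _ _ (t \ox idl C p.2)))); last by mlin.
  by apply: eq_bigr => r _; rewrite tassocE !tliftE.
rewrite coassoc (lin_comul
  (f := fun t => tlift Gb (tmap (idl _) comul t))); last by mlin.
by apply: eq_bigr => p _; rewrite tmapE tliftE (swE _ (Fb _)).
Qed.

Lemma sw_counitl C W (c : C) (F : C -> W) : lin F ->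
  \sw_(c1, c2 <- c) (counit c1 : k) *: F c2 = F c.
Proof.
move=> Fl; rewrite -[c in RHS]counitl.
rewrite (lin_comul (f := fun t => F (tunitl C (tmap counit (idl C) t))));
  last by mlin.
by apply: eq_bigr => p _; rewrite tmapE tunitlE linZ.
Qed.

Lemma sw_counitr C W (c : C) (F : C -> W) : lin F ->
  \sw_(c1, c2 <- c) (counit c2 : k) *: F c1 = F c.
Proof.
move=> Fl; rewrite -[c in RHS]counitr.
rewrite (lin_comul (f := fun t => F (tunitr C (tmap (idl C) counit t))));
  last by mlin.
by apply: eq_bigr => p _; rewrite tmapE tunitrE linZ.
Qed.

Lemma sw_morph C D W (m : {linear C -> D}) (c : C) (F : D -> D -> W) :
  is_coalg_morphism m -> bilin F ->
  \sw_(d1, d2 <- m c) F d1 d2 = \sw_(c1, c2 <- c) F (m c1) (m c2).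
Proof.
move=> [mm _] Fb; rewrite (swE _ Fb) mm.
rewrite (lin_comul (f := fun t => tlift Fb (tmap m m t))); last by mlin.
by apply: eq_bigr => p _; rewrite tmapE tliftE.
Qed.

Lemma sw_tensor C D W (c : C) (d : D) (F : C ⊗ D -> C ⊗ D -> W) : bilin F ->
  sweedler (C := tensor_coalg C D) (c \ox d) F =
  \sw_(c1, c2 <- c) \sw_(d1, d2 <- d) F (c1 \ox d1) (c2 \ox d2).
Proof.
move=> Fb; rewrite (@swE _ (tensor_coalg C D) _ _ _ Fb) [comul _]tensor_comulE.
rewrite (lin_comul
  (f := fun t => tlift Fb (tmid C C D D (t \ox comul d)))); last by mlin.
apply: eq_sw => c1 c2.
rewrite (lin_comul
  (f := fun t => tlift Fb (tmid C C D D ((c1 \ox c2) \ox t)))); last by mlin.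
by apply: eq_sw => d1 d2; rewrite tmidE tliftE.
Qed.

Lemma sw_cop C W (c : C) (F : C -> C -> W) : bilin F ->
  sweedler (C := cop_coalg C) c F = \sw_(c1, c2 <- c) F c2 c1.
Proof.
move=> Fb; rewrite (@swE _ (cop_coalg C) _ _ _ Fb) [comul _]lcompE.
rewrite (lin_comul (f := fun t => tlift Fb (tflip C C t))); last by mlin.
by apply: eq_sw => c1 c2; rewrite tflipE tliftE.
Qed.

(** Compares the two bracketings of a fourfold coproduct: legs grouped two by
    two, or the two middle legs split last, so that a relation can be applied
    to them. *)
Lemma sw_split4 (C : coalgType k) (W : lmodType k) (c : C) (F : C -> C -> C -> C -> W) :
  (forall c2 c3 c4, lin (fun c1 => F c1 c2 c3 c4)) ->
  (forall c1 c3 c4, lin (fun c2 => F c1 c2 c3 c4)) ->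
  (forall c1 c2 c4, lin (fun c3 => F c1 c2 c3 c4)) ->
  (forall c1 c2 c3, lin (fun c4 => F c1 c2 c3 c4)) ->
  \sw_(c', c'' <- c) \sw_(c1, c2 <- c') \sw_(c3, c4 <- c'') F c1 c2 c3 c4 =
  \sw_(c1, c' <- c) \sw_(c'', c4 <- c') \sw_(c2, c3 <- c'') F c1 c2 c3 c4.
Proof.
move=> F1 F2 F3 F4.
rewrite (@sw_coassoc _ _ c (fun c1 c2 c'' => \sw_(c3, c4 <- c'') F c1 c2 c3 c4)); try by mlin.
by apply: eq_sw => c1 c'; rewrite (@sw_coassoc _ _ c' (F c1)) //; mlin.
Qed.

(** Cancelling an invertible action in the convolution algebra: if [g] is a left
    inverse of [f], then [h * f = l] gives [h = l * g]. Acting through the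
    coalgebra morphism [m] is what allows elements such as [c ∶ a] to act. *)
Lemma conv_cancel C D (U : lmodType k) (f g : {linear U ⊗ D -> U})
    (m : {linear C -> D}) (h l : C -> U) :
  (forall u d, \sw_(d1, d2 <- d) g (f (u \ox d1) \ox d2) = (counit d : k) *: u) ->
  is_coalg_morphism m -> lin h -> 
  (forall c, \sw_(c1, c2 <- c) f (h c1 \ox m c2) = l c) ->
  forall c, h c = \sw_(c1, c2 <- c) g (l c1 \ox m c2).
Proof.
move=> gf mm hl fh c; symmetry.
transitivity (\sw_(c1, c2 <- c) \sw_(c11, c12 <- c1)
                g (f (h c11 \ox m c12) \ox m c2)).
  apply: eq_sw => c1 c2; rewrite -fh.
  by apply: (linear_sw (f := fun u => g (u \ox m c2))); mlin.
rewrite (@sw_coassoc _ _ _ (fun c1 c2 c3 => g (f (h c1 \ox m c2) \ox m c3))); try by mlin.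
transitivity (\sw_(c1, c2 <- c) (counit c2 : k) *: h c1); last exact: sw_counitr.
apply: eq_sw => c1 c2.
rewrite -(proj2 mm) -gf (sw_morph _ mm) //; mlin.
Qed.

(** The action [f] coincides with its pullback along [m], so their convolution
    inverses, which are [g] and its pullback, coincide as well. *)
Lemma conv_invariant (C : coalgType k) (U : lmodType k) (f g : {linear U ⊗ C -> U})
    (m : {linear C -> C}) :
  (forall u c, \sw_(c1, c2 <- c) g (f (u \ox c1) \ox c2) = (counit c : k) *: u) ->
  (forall u c, \sw_(c1, c2 <- c) f (g (u \ox c1) \ox c2) = (counit c : k) *: u) ->
  is_coalg_morphism m ->
  (forall u c, f (u \ox m c) = f (u \ox c)) ->
  forall u c, g (u \ox m c) = g (u \ox c).
Proof.
move=> gf fg mm fm u c.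
rewrite [RHS](conv_cancel (h := fun c => g (u \ox c)) (l := fun c => (counit c : k) *: u) gf mm).
- rewrite -[LHS](sw_counitl c (F := fun c => g (u \ox m c))); last by mlin.
  by apply: eq_sw => c1 c2; rewrite tensZl linearZ.
- by mlin.
- by move=> c'; rewrite -fg; apply: eq_sw => c1 c2; rewrite fm.
Qed.

End SweedlerCalculus.

(** * Coalgebra morphisms into tensor products *)

Local Notation "A ⊠ B" := (tensor_coalg A B) (at level 40, left associativity).

Section Morphisms.
Context {k : fieldType}.
Implicit Types (A B C : coalgType k) (W : lmodType k).

(** The extensionality principle for maps that are linear without being bundled,
    such as Sweedler sums depending on a tensor. *)
Lemma tens_ext (U V W : lmodType k) (f g : U ⊗ V -> W) : lin f -> lin g ->
  (forall u v, f (u \ox v) = g (u \ox v)) -> forall t, f t = g t.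
Proof.
move=> fl gl fg; elim/(@tensor_ind k U V) => [|u v t IH]; first by rewrite !lin0.
by rewrite -[u \ox v]scale1r fl gl fg IH.
Qed.

Lemma coalg_morphismP A B (f : {linear A -> B}) :
  is_coalg_morphism f <->
  (forall x, comul (f x) = \sw_(x1, x2 <- x) f x1 \ox f x2) /\
  (forall x, counit (f x) = counit x).
Proof.
have E x : tmap f f (comul x) = \sw_(x1, x2 <- x) f x1 \ox f x2.
  by rewrite sweedler_lin; apply: eq_sw => x1 x2; rewrite tmapE.
by split=> -[fm fe]; split=> // x; rewrite fm E.
Qed.

Lemma idl_morphism A : is_coalg_morphism (idl A).
Proof.
apply/coalg_morphismP; split=> // x; exact: comulE.
Qed.

Lemma lcomp_morphism A B C (f : {linear B -> C}) (g : {linear A -> B}) :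
  is_coalg_morphism f -> is_coalg_morphism g -> is_coalg_morphism (f ∘ g).
Proof.
move=> fm gm; have [fc fe] := iffLR (coalg_morphismP _) fm.
apply/coalg_morphismP; split=> [x|x]; rewrite lcompE; last first.
  by rewrite fe (proj2 gm).
by rewrite fc (sw_morph _ gm) //; mlin.
Qed.

Lemma comul_tens A B (a : A) (b : B) :
  comul (a \ox b : A ⊠ B) =
  \sw_(a1, a2 <- a) \sw_(b1, b2 <- b) (a1 \ox b1) \ox (a2 \ox b2).
Proof.
by rewrite [LHS]comulE sw_tensor //; mlin.
Qed.

Lemma counit_tens A B (a : A) (b : B) :
  counit (a \ox b : A ⊠ B) = counit a * counit b.
Proof. exact: tensor_counitE. Qed.

Lemma tmap_morphism A A' B B' (f : {linear A -> A'}) (g : {linear B -> B'}) :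
  is_coalg_morphism f -> is_coalg_morphism g ->
  is_coalg_morphism (A := A ⊠ B) (B := A' ⊠ B') (tmap f g).
Proof.
move=> fm gm; apply/coalg_morphismP; split; apply: tens_ext; try by mlin.
  move=> a b; rewrite tmapE comul_tens (sw_morph _ fm); last by mlin.
  rewrite sw_tensor; last by mlin.
  apply: eq_sw => a1 a2; rewrite (sw_morph _ gm); last by mlin.
  by apply: eq_sw => b1 b2; rewrite !tmapE.
by move=> a b; rewrite tmapE !counit_tens (proj2 fm) (proj2 gm).
Qed.

Definition projl (A B : coalgType k) : {linear A ⊗ B -> A} :=
  tunitr A ∘ tmap (idl A) counit.
Definition projr (A B : coalgType k) : {linear A ⊗ B -> B} :=
  tunitl B ∘ tmap counit (idl B).

Lemma projlE A B (a : A) (b : B) : projl A B (a \ox b) = (counit b : k) *: a.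
Proof. by rewrite lcompE tmapE tunitrE. Qed.

Lemma projrE A B (a : A) (b : B) : projr A B (a \ox b) = (counit a : k) *: b.
Proof. by rewrite lcompE tmapE tunitlE. Qed.

Lemma projl_morphism A B : is_coalg_morphism (A := A ⊠ B) (projl A B).
Proof.
apply/coalg_morphismP; split; apply: tens_ext; try by mlin.
  move=> a b; rewrite projlE (linZ (f := comul) _ _ (linearP _)) comulE scaler_sw.
  rewrite sw_tensor; last by mlin.
  apply: eq_sw => a1 a2.
  rewrite -(sw_counitl b (F := fun b' => (counit b' : k) *: _)); last by mlin.
  by apply: eq_sw => b1 b2; rewrite !projlE tensZl tensZr.
by move=> a b; rewrite projlE linearZ counit_tens mulrC.
Qed.

Lemma projr_morphism A B : is_coalg_morphism (A := A ⊠ B) (projr A B).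
Proof.
apply/coalg_morphismP; split; apply: tens_ext; try by mlin.
  move=> a b; rewrite projrE (linZ (f := comul) _ _ (linearP _)) comulE scaler_sw.
  rewrite sw_tensor; last by mlin.
  rewrite sw_exchange; apply: eq_sw => b1 b2.
  rewrite -(sw_counitl a (F := fun b' => (counit b' : k) *: _)); last by mlin.
  by apply: eq_sw => a1 a2; rewrite !projrE tensZl tensZr.
by move=> a b; rewrite projrE linearZ counit_tens.
Qed.

(** A tensor is recovered from its two components; [sw_projrl] says that the
    legs of the coproduct may be used in either order, which is where the
    compatibility between the two components of a morphism comes from. *)
Lemma sw_projlr A B (t : A ⊠ B) :
  \sw_(t1, t2 <- t) projl A B t1 \ox projr A B t2 = t.
Proof.
move: t; apply: tens_ext; try by mlin.
move=> a b; rewrite sw_tensor; last by mlin.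
rewrite -[RHS](sw_counitr (W := A ⊗ B) a (F := fun a => a \ox b)); last by mlin.
apply: eq_sw => a1 a2.
rewrite -[RHS](sw_counitl (W := A ⊗ B) b
  (F := fun b => (counit a2 : k) *: (a1 \ox b))); last by mlin.
by apply: eq_sw => b1 b2; rewrite projlE projrE tensZl tensZr.
Qed.

Lemma sw_projrl A B (t : A ⊠ B) :
  \sw_(t1, t2 <- t) projl A B t2 \ox projr A B t1 = t.
Proof.
move: t; apply: tens_ext; try by mlin.
move=> a b; rewrite sw_tensor; last by mlin.
rewrite -[RHS](sw_counitl (W := A ⊗ B) a (F := fun a => a \ox b)); last by mlin.
apply: eq_sw => a1 a2.
rewrite -[RHS](sw_counitr (W := A ⊗ B) b
  (F := fun b => (counit a1 : k) *: (a2 \ox b))); last by mlin.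
by apply: eq_sw => b1 b2;
  rewrite projlE projrE tensZl tensZr scalerA mulrC -scalerA.
Qed.

Lemma tensor_morphism_ext A B C (f g : {linear C -> A ⊗ B}) :
  is_coalg_morphism (B := A ⊠ B) f -> is_coalg_morphism (B := A ⊠ B) g ->
  (forall c, projl A B (f c) = projl A B (g c)) ->
  (forall c, projr A B (f c) = projr A B (g c)) -> forall c, f c = g c.
Proof.
move=> fm gm fgl fgr c; rewrite -(sw_projlr (f c)) -(sw_projlr (g c)).
rewrite (sw_morph _ fm) ?(sw_morph _ gm); try by mlin.
by apply: eq_sw => c1 c2; rewrite fgl fgr.
Qed.

Lemma tassoc_morphism A B C :
  is_coalg_morphism (A := (A ⊠ B) ⊠ C) (B := A ⊠ (B ⊠ C)) (tassoc A B C).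
Proof.
apply/coalg_morphismP; split; apply: tens_ext; try by mlin.
  move=> t c; move: t; apply: tens_ext; try by mlin.
  move=> a b; rewrite tassocE comul_tens sw_tensor; last by mlin.
  rewrite sw_tensor; last by mlin.
  apply: eq_sw => a1 a2; rewrite sw_tensor; last by mlin.
  by apply: eq_sw => b1 b2; apply: eq_sw => c1 c2; rewrite !tassocE.
move=> t c; move: t; apply: tens_ext; try by mlin.
by move=> a b; rewrite tassocE !counit_tens mulrA.
Qed.

Lemma tassocV_morphism A B C :
  is_coalg_morphism (A := A ⊠ (B ⊠ C)) (B := (A ⊠ B) ⊠ C) (tassocV A B C).
Proof.
apply/coalg_morphismP; split; apply: tens_ext; try by mlin.
  move=> a; apply: tens_ext; try by mlin.
  move=> b c; rewrite tassocVE comul_tens !sw_tensor; try by mlin.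
  apply: eq_sw => a1 a2; rewrite sw_tensor; last by mlin.
  by apply: eq_sw => b1 b2; apply: eq_sw => c1 c2; rewrite !tassocVE.
move=> a; apply: tens_ext; try by mlin.
by move=> b c; rewrite tassocVE !counit_tens mulrA.
Qed.

End Morphisms.

(** * The components of the braid equation *)

Section BraidComponents.
Context {k : fieldType} {X : coalgType k} (s : {linear X ⊗ X -> X ⊗ X}).
Hypothesis hs : is_coalg_morphism s.

Lemma s12_morphism : is_coalg_morphism (A := (X ⊠ X) ⊠ X) (B := (X ⊠ X) ⊠ X) (s12 s).
Proof. exact: (tmap_morphism (A := X ⊠ X) (A' := X ⊠ X) hs (idl_morphism X)). Qed.

Lemma s23_morphism : is_coalg_morphism (A := (X ⊠ X) ⊠ X) (B := (X ⊠ X) ⊠ X) (s23 s).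
Proof.
apply: (lcomp_morphism (B := X ⊠ (X ⊠ X))); last exact: tassoc_morphism.
apply: (lcomp_morphism (B := X ⊠ (X ⊠ X))); first exact: tassocV_morphism.
exact: (tmap_morphism (B := X ⊠ X) (B' := X ⊠ X) (idl_morphism X) hs).
Qed.

Lemma s23E x y z : s23 s ((x \ox y) \ox z) = tassocV X X X (x \ox s (y \ox z)).
Proof. by rewrite /s23 2!lcompE tassocE tmapE. Qed.

Lemma projr_s12 t : projr (X ⊠ X) X (s12 s t) = projr (X ⊠ X) X t.
Proof.
move: t; apply: tens_ext; try by mlin.
by move=> u z; rewrite tmapE !projrE hs.2.
Qed.

Lemma projr_s23 t :
  projr (X ⊠ X) X (s23 s t) = s_right s (tmap (projr X X) (idl X) t).
Proof.
move: t; apply: tens_ext; try by mlin.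
move=> u z; move: u; apply: tens_ext; try by mlin.
move=> x y; rewrite s23E tmapE projrE tensZl linearZ.
rewrite -[s_right s _]/(projr X X (s (y \ox z))).
move: (s _); apply: tens_ext; try by mlin.
by move=> y' z'; rewrite tassocVE !projrE counit_tens -scalerA.
Qed.

Lemma tmap_projr_s12 t :
  tmap (projr X X) (idl X) (s12 s t) = tmap (s_right s) (idl X) t.
Proof.
move: t; apply: tens_ext; try by mlin.
by move=> u z; rewrite !tmapE.
Qed.

Lemma projl_s12 t : projl (X ⊠ X) X (s12 s t) = s (projl (X ⊠ X) X t).
Proof.
move: t; apply: tens_ext; try by mlin.
by move=> u z; rewrite tmapE !projlE linearZ.
Qed.

Lemma projl_s23 t :
  projl (X ⊠ X) X (s23 s t) = tmap (idl X) (s_left s) (tassoc X X X t).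
Proof.
move: t; apply: tens_ext; try by mlin.
move=> u z; move: u; apply: tens_ext; try by mlin.
move=> x y; rewrite s23E tassocE tmapE.
rewrite -[s_left s _]/(projl X X (s (y \ox z))).
move: (s _); apply: tens_ext; try by mlin.
by move=> y' z'; rewrite tassocVE !projlE tensZr.
Qed.

Lemma projll_s23 t : projl X X (projl (X ⊠ X) X (s23 s t)) = projl X X (projl (X ⊠ X) X t).
Proof.
rewrite projl_s23; move: t; apply: tens_ext; try by mlin.
move=> u z; move: u; apply: tens_ext; try by mlin.
move=> x y; rewrite tassocE tmapE !projlE (linZ (f := projl X X)) ?projlE;
  last by mlin.
by rewrite (lcomp_morphism (projl_morphism X X) hs).2 counit_tens mulrC -scalerA.
Qed.

Lemma projrl_s23 t :
  projr X X (projl (X ⊠ X) X (s23 s t)) = s_left s (tmap (projr X X) (idl X) t).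
Proof.
rewrite projl_s23; move: t; apply: tens_ext; try by mlin.
move=> u z; move: u; apply: tens_ext; try by mlin.
by move=> x y; rewrite tassocE !tmapE !projrE tensZl linearZ.
Qed.

(** Both sides are coalgebra morphisms, hence determined by their components.
    Since [s12] preserves the last component and [s23] the first one, the
    outermost operator can be dropped on one side of each outer component. *)
Lemma braid_components :
  (forall t, s12 s (s23 s (s12 s t)) = s23 s (s12 s (s23 s t))) <->
  [/\ forall t, s_right s (tmap (s_right s) (idl X) t) =
                s_right s (tmap (s_right s) (idl X) (s23 s t)),
      forall t, s_right s (tmap (idl X) (s_left s) (tassoc X X X (s12 s t))) =
                s_left s (tmap (s_right s) (idl X) (s23 s t)) &
      forall t, s_left s (tmap (idl X) (s_left s) (tassoc X X X (s12 s t))) =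
                s_left s (tmap (idl X) (s_left s) (tassoc X X X t))].
Proof.
pose lhs := s12 s ∘ s23 s ∘ s12 s; pose rhs := s23 s ∘ s12 s ∘ s23 s.
have lhsE t : lhs t = s12 s (s23 s (s12 s t)) by [].
have rhsE t : rhs t = s23 s (s12 s (s23 s t)) by [].
have lhs3 t : projr (X ⊠ X) X (lhs t) = s_right s (tmap (s_right s) (idl X) t).
  by rewrite lhsE projr_s12 projr_s23 tmap_projr_s12.
have rhs3 t : projr (X ⊠ X) X (rhs t) = s_right s (tmap (s_right s) (idl X) (s23 s t)).
  by rewrite rhsE projr_s23 tmap_projr_s12.
have lhs2 t : projr X X (projl (X ⊠ X) X (lhs t)) =
    s_right s (tmap (idl X) (s_left s) (tassoc X X X (s12 s t))).
  by rewrite lhsE projl_s12 projl_s23.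
have rhs2 t : projr X X (projl (X ⊠ X) X (rhs t)) =
    s_left s (tmap (s_right s) (idl X) (s23 s t)).
  by rewrite rhsE projrl_s23 tmap_projr_s12.
have lhs1 t : projl X X (projl (X ⊠ X) X (lhs t)) =
    s_left s (tmap (idl X) (s_left s) (tassoc X X X (s12 s t))).
  by rewrite lhsE projl_s12 projl_s23.
have rhs1 t : projl X X (projl (X ⊠ X) X (rhs t)) =
    s_left s (tmap (idl X) (s_left s) (tassoc X X X t)).
  by rewrite rhsE projll_s23 projl_s12 projl_s23.
split=> [H|[H3 H2 H1]].
  split=> t; first by rewrite -lhs3 -rhs3 lhsE H.
    by rewrite -lhs2 -rhs2 lhsE H.
  by rewrite -lhs1 -rhs1 lhsE H.
pose T := (X ⊠ X) ⊠ X.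
have lm : is_coalg_morphism (A := T) (B := T) lhs.
  apply: (lcomp_morphism (B := T)) s12_morphism.
  exact: (lcomp_morphism (B := T)) s12_morphism s23_morphism.
have rm : is_coalg_morphism (A := T) (B := T) rhs.
  apply: (lcomp_morphism (B := T)) s23_morphism.
  exact: (lcomp_morphism (B := T)) s23_morphism s12_morphism.
apply: (tensor_morphism_ext (C := T) (A := X ⊠ X)
  (f := lhs) (g := rhs)) => // t; last first.
  by rewrite lhs3 rhs3 H3.
apply: (tensor_morphism_ext (C := T)
  (f := projl (X ⊠ X) X ∘ lhs) (g := projl (X ⊠ X) X ∘ rhs)).
- exact: (lcomp_morphism (projl_morphism _ _) lm).
- exact: (lcomp_morphism (projl_morphism _ _) rm).
- by move=> {}t;
  rewrite -[LHS]/(projl X X (projl (X ⊠ X) X (lhs t))) lhs1 H1 -rhs1.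
- by move=> {}t;
  rewrite -[LHS]/(projr X X (projl (X ⊠ X) X (lhs t))) lhs2 H2 -rhs2.
Qed.

End BraidComponents.

(** * The two operations associated with a solution *)

Section Associated.
Context {k : fieldType} {X : coalgType k} (s : {linear X ⊗ X -> X ⊗ X}).
Hypotheses (hs : is_coalg_morphism s) (nd : left_nondegenerate s).

Local Notation "x ▷ y" := (s_left s (x \ox y)) (at level 35, y at next level).
Local Notation "x ◁ y" := (s_right s (x \ox y)) (at level 35, y at next level).
Local Notation "x ⋅ y" := (induced_dot nd (x \ox y)) (at level 35, y at next level).
Local Notation "x ∶ y" := (induced_colon nd (x \ox y)) (at level 35, y at next level).

Lemma s_left_morphism : is_coalg_morphism (A := X ⊠ X) (s_left s).
Proof. exact: lcomp_morphism (projl_morphism X X) hs. Qed.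

Lemma s_right_morphism : is_coalg_morphism (A := X ⊠ X) (s_right s).
Proof. exact: lcomp_morphism (projr_morphism X X) hs. Qed.

Lemma comul_s_left x y :
  comul (x ▷ y) = \sw_(x1, x2 <- x) \sw_(y1, y2 <- y) (x1 ▷ y1) \ox (x2 ▷ y2).
Proof.
by rewrite (iffLR (coalg_morphismP _) s_left_morphism).1 sw_tensor //; mlin.
Qed.

Lemma comul_s_right x y :
  comul (x ◁ y) = \sw_(x1, x2 <- x) \sw_(y1, y2 <- y) (x1 ◁ y1) \ox (x2 ◁ y2).
Proof.
by rewrite (iffLR (coalg_morphismP _) s_right_morphism).1 sw_tensor //; mlin.
Qed.

Lemma counit_s_left x y : counit (x ▷ y) = counit x * counit y.
Proof. by rewrite (proj2 s_left_morphism) counit_tens. Qed.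

Lemma counit_s_right x y : counit (x ◁ y) = counit x * counit y.
Proof. by rewrite (proj2 s_right_morphism) counit_tens. Qed.

(** The two expressions of [s] by its components differ by the order of the legs
    and are both needed: only [s_swC] puts the legs next to each other in
    [s_lin_inv], and only [s_sw] does in [colon_dot]. *)
Lemma s_sw x y :
  s (x \ox y) = \sw_(x1, x2 <- x) \sw_(y1, y2 <- y) (x1 ▷ y1) \ox (x2 ◁ y2).
Proof.
rewrite -[LHS]sw_projlr (sw_morph _ hs); last by mlin.
by rewrite sw_tensor //; mlin.
Qed.

Lemma s_swC x y :
  s (x \ox y) = \sw_(x1, x2 <- x) \sw_(y1, y2 <- y) (x2 ▷ y2) \ox (x1 ◁ y1).
Proof.
rewrite -[LHS]sw_projrl (sw_morph _ hs); last by mlin.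
by rewrite sw_tensor //; mlin.
Qed.

Lemma projl_twist (m : {linear X ⊗ X -> X}) t : projl X X (twist m t) = m t.
Proof.
move: t; apply: tens_ext; try by mlin.
move=> x y; rewrite twistE (linear_sw (f := projl X X)); last by mlin.
rewrite -[RHS](sw_counitr y (F := fun y => m (x \ox y))); last by mlin.
by apply: eq_sw => y1 y2; rewrite projlE.
Qed.

(** Colinearity over the second factor forces the inverse of a twisted map to be
    a twisted map again; see [lin_inv_twist]. *)
Lemma twist_colinear (m : {linear X ⊗ X -> X}) t :
  tassocV X X X (tmap (idl X) comul (twist m t)) =
  tmap (twist m) (idl X) (tassocV X X X (tmap (idl X) comul t)).
Proof.
move: t; apply: tens_ext; try by mlin.
move=> x y; rewrite twistE tmapE.
rewrite (linear_sw (f := fun t => tassocV X X X (tmap (idl X) comul t)));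
  last by mlin.
rewrite (lin_comul
  (f := fun t => tmap (twist m) (idl X) (tassocV X X X (idl X x \ox t))));
    last by mlin.
transitivity (\sw_(y1, y2 <- y) \sw_(y21, y22 <- y2) ((m (x \ox y1)) \ox y21) \ox y22).
  apply: eq_sw => y1 y2; rewrite tmapE comulE.
  rewrite (linear_sw (f := fun t => tassocV X X X (_ \ox t))); last by mlin.
  by apply: eq_sw => y21 y22; rewrite tassocVE.
rewrite -(@sw_coassoc _ _ _ y (fun y1 y2 y3 => ((m (x \ox y1)) \ox y2) \ox y3)); try by mlin.
apply: eq_sw => y1 y2; rewrite tassocVE tmapE twistE.
by rewrite (linear_sw (f := fun t => t \ox idl X y2)) //; mlin.
Qed.

Lemma lin_inv_twist t : lin_inv nd t = twist (induced_dot nd) t.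
Proof.
have E : tassocV X X X (tmap (idl X) comul (lin_inv nd t)) =
    tmap (lin_inv nd) (idl X) (tassocV X X X (tmap (idl X) comul t)).
  rewrite -[in RHS](lin_invK nd t) /Gmap twist_colinear -[twist _]/(Gmap s).
  move: (tassocV _ _ _ _); apply: tens_ext; try by mlin.
  by move=> u x; rewrite !tmapE lin_invKV.
have := congr1 (tmap (projl X X) (idl X)) E.
have -> v : tmap (projl X X) (idl X) (tassocV X X X (tmap (idl X) comul v)) = v.
  move: v; apply: tens_ext; try by mlin.
  move=> x y; rewrite tmapE.
  rewrite (lin_comul
    (f := fun t => tmap (projl X X) (idl X) (tassocV X X X (_ \ox t))));
      last by mlin.
  rewrite -[RHS](sw_counitl y (F := fun y => x \ox y)); last by mlin.
  by apply: eq_sw => y1 y2; rewrite tassocVE tmapE projlE tensZl.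
move=> ->; rewrite [RHS]lcompE [in RHS]lcompE.
move: (tassocV _ _ _ _); apply: tens_ext; try by mlin.
by move=> u x; rewrite !tmapE.
Qed.

Lemma lin_invE x y : lin_inv nd (x \ox y) = \sw_(y1, y2 <- y) (x ⋅ y1) \ox y2.
Proof. by rewrite lin_inv_twist twistE. Qed.

Lemma dot_right x y : \sw_(y1, y2 <- y) (x ⋅ y1) ◁ y2 = (counit y : k) *: x.
Proof.
rewrite -projlE -(lin_invK nd (x \ox y)) projl_twist lin_invE.
by rewrite (linear_sw (f := s_right s)) //; mlin.
Qed.

Lemma right_dot x y : \sw_(y1, y2 <- y) (x ◁ y1) ⋅ y2 = (counit y : k) *: x.
Proof.
rewrite -projlE -(lin_invKV nd (x \ox y)) lin_inv_twist projl_twist twistE.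
by rewrite (linear_sw (f := induced_dot nd)) //; mlin.
Qed.

Lemma colonE c a : c ∶ a = \sw_(c1, c2 <- c) (a ⋅ c1) ▷ c2.
Proof. exact: induced_colonE. Qed.

Lemma counit_dot x y : counit (x ⋅ y) = counit x * counit y.
Proof.
transitivity (\sw_(y1, y2 <- y) (counit y2 : k) *: (counit (x ⋅ y1) : k^⊙)).
  by rewrite (sw_counitr y (F := fun y => counit (x ⋅ y) : k^⊙)) //; mlin.
transitivity (counit (\sw_(y1, y2 <- y) (x ⋅ y1) ◁ y2)).
  rewrite (linear_sw (f := counit)); last by mlin.
  by apply: eq_sw => y1 y2; rewrite counit_s_right mulrC.
by rewrite dot_right linearZ mulrC.
Qed.

Lemma counit_colon x y : counit (x ∶ y) = counit x * counit y.
Proof.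
rewrite colonE (linear_sw (f := counit)); last by mlin.
transitivity (\sw_(x1, x2 <- x) (counit x1 : k) *: (counit x2 * counit y : k^⊙)).
  apply: eq_sw => x1 x2; rewrite counit_s_left counit_dot.
  by rewrite [counit y * _]mulrC -mulrA [counit y * _]mulrC.
rewrite (sw_counitl x (F := fun x => counit x * counit y : k^⊙)) //.
by move=> a u v; rewrite linearP /= mulrDl -scalerAl.
Qed.

(** The diagonal action of [X] on [X ⊗ X] and its convolution inverse, in which
    the legs occur in the opposite order. *)
Definition diag_right : {linear (X ⊗ X) ⊗ X -> X ⊗ X} :=
  tmap (s_right s) (s_right s) ∘ tmid X X X X ∘ tmap (idl (X ⊗ X)) comul.
Definition diag_dot : {linear (X ⊗ X) ⊗ X -> X ⊗ X} :=
  tmap (induced_dot nd) (induced_dot nd) ∘ tmid X X X X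
  ∘ tmap (idl (X ⊗ X)) (tflip X X ∘ comul).

Lemma diag_rightE a b y :
  diag_right ((a \ox b) \ox y) = \sw_(y1, y2 <- y) (a ◁ y1) \ox (b ◁ y2).
Proof.
rewrite /diag_right !lcompE tmapE.
rewrite (lin_comul (f := fun t => tmap _ _ (tmid X X X X (_ \ox t))));
  last by mlin.
by apply: eq_sw => y1 y2; rewrite tmidE tmapE.
Qed.

Lemma diag_dotE a b y :
  diag_dot ((a \ox b) \ox y) = \sw_(y1, y2 <- y) (a ⋅ y2) \ox (b ⋅ y1).
Proof.
rewrite /diag_dot !lcompE tmapE lcompE.
rewrite (lin_comul
  (f := fun t => tmap _ _ (tmid X X X X (_ \ox tflip X X t)))); last by mlin.
by apply: eq_sw => y1 y2; rewrite tflipE tmidE tmapE.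
Qed.

Lemma diag_dot_right u y :
  \sw_(y1, y2 <- y) diag_dot (diag_right (u \ox y1) \ox y2) = (counit y : k) *: u.
Proof.
move: u; apply: tens_ext; try by mlin.
move=> a b.
pose F (y1 y2 y3 y4 : X) : X ⊗ X := ((a ◁ y1) ⋅ y4) \ox ((b ◁ y2) ⋅ y3).
transitivity (\sw_(y1, y2 <- y) \sw_(y11, y12 <- y1) \sw_(y21, y22 <- y2)
                F y11 y12 y21 y22).
  apply: eq_sw => y1 y2; rewrite diag_rightE.
  rewrite (linear_sw (f := fun t => diag_dot (t \ox y2))); last by mlin.
  by apply: eq_sw => y11 y12; rewrite diag_dotE.
rewrite /F (@sw_coassoc _ _ _ y (fun y1 y2 y3 => \sw_(y31, y32 <- y3) F y1 y2 y31 y32));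
  rewrite /F; try by mlin.
transitivity (\sw_(y1, y2 <- y) ((a ◁ y1) ⋅ y2) \ox b).
  apply: eq_sw => y1 y'.
  (* The legs y2 and y3 are adjacent and cancel; afterwards y1 and y4 are. *)
  rewrite -(@sw_coassoc _ _ _ y' (fun y2 y3 y4 => F y1 y2 y3 y4));
    rewrite /F; try by mlin.
  rewrite -[RHS](sw_counitl y' (F := fun y' => ((a ◁ y1) ⋅ y') \ox b));
    last by mlin.
  apply: eq_sw => u y4.
  rewrite -(linear_sw (f := fun t => _ \ox t)); last by mlin.
  by rewrite right_dot tensZr.
rewrite -(linear_sw (f := fun t => t \ox b)); last by mlin.
by rewrite right_dot tensZl.
Qed.

(** The right action [◁] respects coproducts, that is [Δ] intertwines it with the
    diagonal action on [X ⊗ X]; hence [Δ] intertwines the inverses. *)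
Lemma comul_dot x y :
  comul (x ⋅ y) = \sw_(x1, x2 <- x) \sw_(y1, y2 <- y) (x1 ⋅ y2) \ox (x2 ⋅ y1).
Proof.
rewrite (conv_cancel (h := fun y => comul (x ⋅ y))
  (l := fun y => (counit y : k) *: comul x) diag_dot_right (idl_morphism X)); last first.
- move=> c; transitivity (comul (\sw_(c1, c2 <- c) (x ⋅ c1) ◁ c2)).
    rewrite (linear_sw (f := comul)); last by mlin.
    apply: eq_sw => c1 c2; rewrite comul_s_right //.
    rewrite (lin_comul (f := fun t => diag_right (t \ox _))); last by mlin.
    by apply: eq_sw => x1 x2; rewrite diag_rightE.
  by rewrite dot_right linearZ.
- by mlin.
transitivity (diag_dot (comul x \ox y)).
  rewrite -[RHS](sw_counitl y (F := fun y => diag_dot (_ \ox y))); last by mlin.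
  by apply: eq_sw => y1 y2; rewrite tensZl linearZ.
rewrite (lin_comul (f := fun t => diag_dot (t \ox _))); last by mlin.
by apply: eq_sw => x1 x2; rewrite diag_dotE.
Qed.

Lemma sw_dot x y (W : lmodType k) (F : X -> X -> W) : bilin F ->
  \sw_(u1, u2 <- x ⋅ y) F u1 u2 =
  \sw_(x1, x2 <- x) \sw_(y1, y2 <- y) F (x1 ⋅ y2) (x2 ⋅ y1).
Proof.
move=> Fb; rewrite (swE _ Fb) comul_dot.
rewrite (linear_sw (f := tlift Fb)); last by mlin.
apply: eq_sw => x1 x2; rewrite (linear_sw (f := tlift Fb)); last by mlin.
by apply: eq_sw => y1 y2; rewrite tliftE.
Qed.

(** With [Δ(b ⋅ c) = b_1 ⋅ c_2 ⊗ b_2 ⋅ c_1] the second factor contains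
    [(b_1 ⋅ c_2) ◁ c_3], which collapses to [b_1]. *)
Lemma s_lin_inv b c :
  s (lin_inv nd (b \ox c)) = \sw_(b1, b2 <- b) (c ∶ b2) \ox b1.
Proof.
rewrite lin_invE (linear_sw (f := s)); last by mlin.
pose F (b1 b2 c1 c2 c3 c4 : X) : X ⊗ X := ((b2 ⋅ c1) ▷ c4) \ox ((b1 ⋅ c2) ◁ c3).
transitivity (\sw_(b1, b2 <- b) \sw_(c1, c2 <- c) \sw_(c11, c12 <- c1)
                \sw_(c21, c22 <- c2) F b1 b2 c11 c12 c21 c22).
  transitivity (\sw_(c1, c2 <- c) \sw_(b1, b2 <- b) \sw_(c11, c12 <- c1)
                \sw_(c21, c22 <- c2) F b1 b2 c11 c12 c21 c22).
    by apply: eq_sw => c1 c2; rewrite s_swC // sw_dot //; mlin.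
  exact: sw_exchange.
apply: eq_sw => b1 b2; rewrite colonE.
rewrite (linear_sw (f := fun t => t \ox b1)); last by mlin.
rewrite (@sw_coassoc _ _ _ c (fun c1 c2 c3 => \sw_(c31, c32 <- c3) F b1 b2 c1 c2 c31 c32));
  rewrite /F; try by mlin.
apply: eq_sw => c1 c'.
rewrite -(@sw_coassoc _ _ _ c' (fun c2 c3 c4 => F b1 b2 c1 c2 c3 c4));
  rewrite /F; try by mlin.
rewrite -[RHS](sw_counitl c' (F := fun c' => ((b2 ⋅ c1) ▷ c') \ox b1));
  last by mlin.
apply: eq_sw => u c4.
rewrite -(linear_sw (f := fun t => _ \ox t)); last by mlin.
by rewrite dot_right tensZr.
Qed.

(** The action [◁] on the second factor of [X ⊗ X] and its inverse. *)
Definition right_on2 : {linear (X ⊗ X) ⊗ X -> X ⊗ X} :=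
  tmap (idl X) (s_right s) ∘ tassoc X X X.
Definition dot_on2 : {linear (X ⊗ X) ⊗ X -> X ⊗ X} :=
  tmap (idl X) (induced_dot nd) ∘ tassoc X X X.

(** Acting on the second factor by a further leg of [c] turns the right-hand side
    into [s (G^-1 (a ⊗ c)) = (c ∶ a_2) ⊗ a_1]; cancelling this action gives the
    left-hand side. *)
Lemma colon_dot a c :
  \sw_(a1, a2 <- a) \sw_(c1, c2 <- c) (c1 ∶ a2) \ox (a1 ⋅ c2) =
  \sw_(c1, c2 <- c) \sw_(u1, u2 <- a ⋅ c1) (u1 ▷ c2) \ox u2.
Proof.
symmetry.
have dr2 u y : \sw_(y1, y2 <- y) dot_on2 (right_on2 (u \ox y1) \ox y2) = (counit y : k) *: u.
  move: u; apply: tens_ext; try by mlin.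
  move=> v w;
    rewrite -tensZr -(right_dot w y) (linear_sw (f := fun t => v \ox t));
      last by mlin.
  by apply: eq_sw => y1 y2; rewrite /right_on2 /dot_on2 !(lcompE, tassocE, tmapE).
rewrite (conv_cancel
  (f := right_on2) (m := idl X)
  (h := fun c => \sw_(c1, c2 <- c) \sw_(u1, u2 <- a ⋅ c1) (u1 ▷ c2) \ox u2)
  (l := fun c => \sw_(a1, a2 <- a) (c ∶ a2) \ox a1) dr2 (idl_morphism X)); last first.
- move=> {}c; rewrite -s_lin_inv lin_invE (linear_sw (f := s)); last by mlin.
  transitivity (\sw_(c1, c2 <- c) \sw_(c11, c12 <- c1)
     \sw_(u1, u2 <- a ⋅ c11) (u1 ▷ c12) \ox (u2 ◁ c2)).
    apply: eq_sw => c1 c2;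
      rewrite (linear_sw (f := fun t => right_on2 (t \ox idl X c2)));
        last by mlin.
    apply: eq_sw => c11 c12;
      rewrite (linear_sw (f := fun t => right_on2 (t \ox idl X c2)));
        last by mlin.
    by apply: eq_sw => u1 u2; rewrite /right_on2 lcompE tassocE tmapE.
  rewrite (@sw_coassoc _ _ _ c
    (fun c1 c2 c3 => \sw_(u1, u2 <- a ⋅ c1) (u1 ▷ c2) \ox (u2 ◁ c3)));
      try by mlin.
  by apply: eq_sw => c1 c2; rewrite sw_exchange s_sw.
- by mlin.
rewrite sw_exchange; apply: eq_sw => c1 c2.
rewrite (linear_sw (f := fun t => dot_on2 (t \ox idl X c2))); last by mlin.
by apply: eq_sw => a1 a2; rewrite /dot_on2 lcompE tassocE tmapE.
Qed.

Lemma colon_dotC a c :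
  \sw_(a1, a2 <- a) \sw_(c1, c2 <- c) (c1 ∶ a2) \ox (a1 ⋅ c2) =
  \sw_(a1, a2 <- a) \sw_(c1, c2 <- c) (c2 ∶ a1) \ox (a2 ⋅ c1).
Proof.
rewrite colon_dot; transitivity (\sw_(c1, c2 <- c) \sw_(a1, a2 <- a)
  \sw_(c11, c12 <- c1) ((a1 ⋅ c12) ▷ c2) \ox (a2 ⋅ c11)).
  by apply: eq_sw => c1 c2; rewrite sw_dot //; mlin.
rewrite sw_exchange; apply: eq_sw => a1 a2.
rewrite (@sw_coassoc _ _ _ c (fun c1 c2 c3 => ((a1 ⋅ c2) ▷ c3) \ox (a2 ⋅ c1))); try by mlin.
apply: eq_sw => c1 c2; rewrite colonE.
by rewrite (linear_sw (f := fun t => t \ox _)) //; mlin.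
Qed.

(** As [▷] respects coproducts, the left-hand side is a sum of terms
    [u_1 ▷ c_2 ⊗ u_2 ▷ c_3] with [u = a ⋅ c_1], to which [colon_dot] applies. *)
Lemma comul_colon c a :
  comul (c ∶ a) = \sw_(a1, a2 <- a) \sw_(c1, c2 <- c) (c1 ∶ a2) \ox (c2 ∶ a1).
Proof.
rewrite colonE (linear_sw (f := comul)); last by mlin.
pose F (c1 c2 c3 : X) : X ⊗ X := \sw_(u1, u2 <- a ⋅ c1) (u1 ▷ c2) \ox (u2 ▷ c3).
transitivity (\sw_(c1, c2 <- c) \sw_(c21, c22 <- c2) F c1 c21 c22).
  by apply: eq_sw => c1 c2; rewrite comul_s_left // sw_exchange.
rewrite -(@sw_coassoc _ _ _ c F) /F; try by mlin.
transitivity (\sw_(c', c3 <- c) \sw_(a1, a2 <- a) \sw_(c1, c2 <- c')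
    (c1 ∶ a2) \ox ((a1 ⋅ c2) ▷ c3)).
  apply: eq_sw => c' c3; pose f t := tmap (idl X) (s_left s) (tassoc X X X (t \ox c3)).
  transitivity (f (\sw_(c1, c2 <- c') \sw_(u1, u2 <- a ⋅ c1) (u1 ▷ c2) \ox u2)).
    rewrite (linear_sw (f := f)); last by rewrite /f; mlin.
    apply: eq_sw => c1 c2; rewrite (linear_sw (f := f)); last by rewrite /f; mlin.
    by apply: eq_sw => u1 u2; rewrite /f tassocE tmapE.
  rewrite -colon_dot (linear_sw (f := f)); last by rewrite /f; mlin.
  apply: eq_sw => a1 a2; rewrite (linear_sw (f := f)); last by rewrite /f; mlin.
  by apply: eq_sw => c1 c2; rewrite /f tassocE tmapE.
rewrite sw_exchange; apply: eq_sw => a1 a2.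
rewrite (@sw_coassoc _ _ _ c (fun c1 c2 c3 => (c1 ∶ a2) \ox ((a1 ⋅ c2) ▷ c3))); try by mlin.
apply: eq_sw => c1 c2; rewrite (colonE c2 a1).
by rewrite (linear_sw (f := fun t => _ \ox t)) //; mlin.
Qed.

Lemma sw_colon c a (W : lmodType k) (F : X -> X -> W) : bilin F ->
  \sw_(u1, u2 <- c ∶ a) F u1 u2 =
  \sw_(a1, a2 <- a) \sw_(c1, c2 <- c) F (c1 ∶ a2) (c2 ∶ a1).
Proof.
move=> Fb; rewrite (swE _ Fb) comul_colon //.
rewrite (linear_sw (f := tlift Fb)); last by mlin.
apply: eq_sw => a1 a2; rewrite (linear_sw (f := tlift Fb)); last by mlin.
by apply: eq_sw => c1 c2; rewrite tliftE.
Qed.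

(** Both sides of the comultiplicativity condition are sums over four legs of [x]
    and of [y]; they agree except on the middle legs, where they are the two
    sides of [colon_dotC]. *)
Lemma qmagma_map_morphism : is_coalg_morphism (qmagma_map (associated_qmagma nd)).
Proof.
set f := qmagma_map _.
have fE (x y : X) : f (x \ox y) = \sw_(x1, x2 <- x) \sw_(y1, y2 <- y) (y1 ∶ x2) \ox (x1 ⋅ y2).
  exact: qmagma_mapE.
apply/(coalg_morphismP (A := X ⊠ cop_coalg X) (B := cop_coalg X ⊠ X)).
split; apply: tens_ext; try by mlin.
- move=> x y; move: (y : X) => {}y; rewrite fE.
  pose F x1 x2 x3 x4 y1 y2 y3 y4 : (X ⊗ X) ⊗ (X ⊗ X) :=
    ((y2 ∶ x3) \ox (x1 ⋅ y4)) \ox ((y1 ∶ x4) \ox (x2 ⋅ y3)).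
  transitivity (\sw_(x1, x2 <- x) \sw_(y1, y2 <- y)
     \sw_(x3, x4 <- x2) \sw_(z1, z2 <- y1) \sw_(w1, w2 <- x1) \sw_(y3, y4 <- y2)
      F w1 w2 x3 x4 z1 z2 y3 y4).
    rewrite (linear_sw (f := comul)); last by mlin.
    apply: eq_sw => x1 x2; rewrite (linear_sw (f := comul)); last by mlin.
    apply: eq_sw => y1 y2; rewrite comul_tens.
    rewrite sw_cop; last by mlin.
    rewrite sw_colon; last by mlin.
    apply: eq_sw => x3 x4; apply: eq_sw => y3 y4.
    by rewrite sw_dot //; mlin.
  transitivity (\sw_(x1, x2 <- x) \sw_(w1, w2 <- x1) \sw_(x3, x4 <- x2)
     \sw_(y1, y2 <- y) \sw_(z1, z2 <- y1) \sw_(y3, y4 <- y2)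
      F w1 w2 x3 x4 z1 z2 y3 y4).
    apply: eq_sw => x1 x2; rewrite sw_exchange [RHS]sw_exchange.
    apply: eq_sw => x3 x4; rewrite [RHS]sw_exchange; apply: eq_sw => y1 y2.
    by rewrite [RHS]sw_exchange; apply: eq_sw => z1 z2.
  pose F' x1 x2 x3 x4 y1 y2 y3 y4 : (X ⊗ X) ⊗ (X ⊗ X) :=
    ((y3 ∶ x2) \ox (x1 ⋅ y4)) \ox ((y1 ∶ x4) \ox (x3 ⋅ y2)).
  transitivity (\sw_(x1, x2 <- x) \sw_(w1, w2 <- x1) \sw_(x3, x4 <- x2)
     \sw_(y1, y2 <- y) \sw_(z1, z2 <- y1) \sw_(y3, y4 <- y2)
      F' w1 w2 x3 x4 z1 z2 y3 y4); last first.
    rewrite (sw_tensor (C := X) (D := cop_coalg X)); last by mlin.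
    apply: eq_sw => x1 x2; rewrite sw_cop; last by mlin.
    transitivity (\sw_(y1, y2 <- y) \sw_(w1, w2 <- x1) \sw_(x3, x4 <- x2)
       \sw_(z1, z2 <- y1) \sw_(y3, y4 <- y2) F' w1 w2 x3 x4 z1 z2 y3 y4).
      by rewrite [RHS]sw_exchange; apply: eq_sw => w1 w2;
        rewrite [RHS]sw_exchange.
    apply: eq_sw => y1 y2; rewrite !fE.
    rewrite (linear_sw (f := fun t => t \ox _)); last by mlin.
    apply: eq_sw => w1 w2; rewrite (linear_sw (f := fun t => _ \ox t));
      last by mlin.
    apply: eq_sw => x3 x4;
      rewrite sw_exchange (linear_sw (f := fun t => t \ox _)); last by mlin.
    by apply: eq_sw => y3 y4;
      rewrite (linear_sw (f := fun t => _ \ox t)) //; mlin.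
  rewrite (@sw_split4 _ _ _ x (fun w1 w2 x3 x4 => \sw_(y1, y2 <- y) \sw_(z1, z2 <- y1)
    \sw_(y3, y4 <- y2) F w1 w2 x3 x4 z1 z2 y3 y4)); rewrite /F; try by mlin.
  rewrite (@sw_split4 _ _ _ x (fun w1 w2 x3 x4 => \sw_(y1, y2 <- y) \sw_(z1, z2 <- y1)
    \sw_(y3, y4 <- y2) F' w1 w2 x3 x4 z1 z2 y3 y4)); rewrite /F'; try by mlin.
  apply: eq_sw => x1 x'; apply: eq_sw => x'' x4.
  (* L fills in the outer legs, leaving the middle ones to [colon_dotC]. *)
  pose L (y1 y4 : X) : {linear X ⊗ X -> (X ⊗ X) ⊗ (X ⊗ X)} :=
    tmap (tensr X (x1 ⋅ y4)) (tensl X (y1 ∶ x4)).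
  transitivity (\sw_(y1, y' <- y) \sw_(y'', y4 <- y')
    L y1 y4 (\sw_(x2, x3 <- x'') \sw_(y2, y3 <- y'') (y2 ∶ x3) \ox (x2 ⋅ y3))).
    transitivity (\sw_(x2, x3 <- x'') \sw_(y1, y' <- y) \sw_(y'', y4 <- y')
       \sw_(y2, y3 <- y'') F x1 x2 x3 x4 y1 y2 y3 y4).
      by apply: eq_sw => x2 x3; rewrite sw_split4 //; rewrite /F; mlin.
    rewrite sw_exchange; apply: eq_sw => y1 y'.
    rewrite sw_exchange; apply: eq_sw => y'' y4.
    rewrite (linear_sw (f := L y1 y4)); last by mlin.
    apply: eq_sw => x2 x3; rewrite (linear_sw (f := L y1 y4)); last by mlin.
    by apply: eq_sw => y2 y3; rewrite tmapE.
  transitivity (\sw_(y1, y' <- y) \sw_(y'', y4 <- y')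
    L y1 y4 (\sw_(x2, x3 <- x'') \sw_(y2, y3 <- y'') (y3 ∶ x2) \ox (x3 ⋅ y2))).
    by apply: eq_sw => y1 y'; apply: eq_sw => y'' y4; rewrite colon_dotC.
  symmetry.
  transitivity (\sw_(x2, x3 <- x'') \sw_(y1, y' <- y) \sw_(y'', y4 <- y')
     \sw_(y2, y3 <- y'') F' x1 x2 x3 x4 y1 y2 y3 y4).
    by apply: eq_sw => x2 x3; rewrite sw_split4 //; rewrite /F'; mlin.
  rewrite sw_exchange; apply: eq_sw => y1 y'.
  rewrite sw_exchange; apply: eq_sw => y'' y4.
  rewrite (linear_sw (f := L y1 y4)); last by mlin.
  apply: eq_sw => x2 x3; rewrite (linear_sw (f := L y1 y4)); last by mlin.
  by apply: eq_sw => y2 y3; rewrite tmapE.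
- move=> x y; move: (y : X) => {}y; rewrite fE [RHS]counit_tens.
  rewrite (linear_sw (f := counit)); last by mlin.
  rewrite -(sw_counitr x (F := fun x => counit x * counit y : k^⊙)); last first.
    by move=> a u v; rewrite linearP /= mulrDl -scalerAl.
  apply: eq_sw => x1 x2; rewrite (linear_sw (f := counit)); last by mlin.
  rewrite -(sw_counitr y
    (F := fun y => (counit x2 : k) *: (counit x1 * counit y : k^⊙))); last first.
    by move=> a u v;
      rewrite linearP /= mulrDr scalerDr -!scalerAr scalerA mulrC -scalerA.
  apply: eq_sw => y1 y2;
    rewrite counit_tens [counit (_ ∶ _)]counit_colon // counit_dot //.
  rewrite /GRing.scale /=; ring.
Qed.

Lemma associated_left_regular : left_regular (associated_qmagma nd).
Proof.
exists (Gmap s) => t; rewrite -lin_inv_twist.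
  exact: lin_invK.
exact: lin_invKV.
Qed.

Lemma associated_qmagma_coalgebra : is_qmagma_coalgebra (associated_qmagma nd).
Proof.
split; [exact: counit_dot | exact: counit_colon | exact: qmagma_map_morphism].
Qed.

(** * Invariance of the iterated action and the first identity *)

(** The iterated action of [X ⊗ X] on [X] and its convolution inverse. *)
Definition right2 : {linear X ⊗ (X ⊗ X) -> X} :=
  s_right s ∘ tmap (s_right s) (idl X) ∘ tassocV X X X.
Definition dot2 : {linear X ⊗ (X ⊗ X) -> X} :=
  induced_dot nd ∘ tmap (induced_dot nd) (idl X) ∘ tassocV X X X
  ∘ tmap (idl X) (tflip X X).

Lemma right2E x y z : right2 (x \ox (y \ox z)) = (x ◁ y) ◁ z.
Proof. by rewrite /right2 !lcompE tassocVE tmapE. Qed.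

Lemma dot2E x y z : dot2 (x \ox (y \ox z)) = (x ⋅ z) ⋅ y.
Proof. by rewrite /dot2 !lcompE tmapE tflipE tassocVE tmapE. Qed.

Lemma dot2_right2 u (t : X ⊠ X) :
  \sw_(t1, t2 <- t) dot2 (right2 (u \ox t1) \ox t2) = (counit t : k) *: u.
Proof.
move: t; apply: tens_ext; try by mlin.
move=> y z; rewrite sw_tensor; last by mlin.
rewrite counit_tens mulrC -scalerA -(right_dot u y) scaler_sw.
apply: eq_sw => y1 y2; rewrite -linearZ -tensZl -(right_dot (u ◁ y1) z).
rewrite (linear_sw (f := fun t => induced_dot nd (t \ox _))); last by mlin.
by apply: eq_sw => z1 z2; rewrite right2E dot2E.
Qed.

Lemma right2_dot2 u (t : X ⊠ X) :
  \sw_(t1, t2 <- t) right2 (dot2 (u \ox t1) \ox t2) = (counit t : k) *: u.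
Proof.
move: t; apply: tens_ext; try by mlin.
move=> y z; rewrite sw_tensor; last by mlin.
rewrite sw_exchange counit_tens -scalerA -(dot_right u z) scaler_sw.
apply: eq_sw => z1 z2; rewrite -linearZ -tensZl -(dot_right (u ⋅ z1) y).
rewrite (linear_sw (f := fun t => s_right s (t \ox _))); last by mlin.
by apply: eq_sw => y1 y2; rewrite right2E dot2E.
Qed.

(** As [G^-1] is onto, its values on pure tensors span [X ⊗ X]. *)
Lemma lin_inv_ext (W : lmodType k) (f g : X ⊗ X -> W) : lin f -> lin g ->
  (forall b c, f (lin_inv nd (b \ox c)) = g (lin_inv nd (b \ox c))) ->
  forall t, f t = g t.
Proof.
move=> fl gl fg t; rewrite -(lin_invKV nd t).
by move: (Gmap s t); apply: tens_ext; try by mlin.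
Qed.

Lemma right2_invariantP :
  (forall x t, right2 (x \ox s t) = right2 (x \ox t)) <->
  (forall x t, dot2 (x \ox s t) = dot2 (x \ox t)).
Proof.
split=> H.
- exact: (conv_invariant (C := X ⊠ X) dot2_right2 right2_dot2 hs H).
- exact: (conv_invariant (C := X ⊠ X) right2_dot2 dot2_right2 hs H).
Qed.

Lemma dot2_lin_inv a b c :
  dot2 (a \ox lin_inv nd (b \ox c)) = \sw_(c1, c2 <- c) (a ⋅ c2) ⋅ (b ⋅ c1).
Proof.
rewrite lin_invE (linear_sw (f := fun t => dot2 (a \ox t))); last by mlin.
by apply: eq_sw => c1 c2; rewrite dot2E.
Qed.

Lemma dot2_s_lin_inv a b c :
  dot2 (a \ox s (lin_inv nd (b \ox c))) = \sw_(b1, b2 <- b) (a ⋅ b1) ⋅ (c ∶ b2).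
Proof.
rewrite s_lin_inv // (linear_sw (f := fun t => dot2 (a \ox t))); last by mlin.
by apply: eq_sw => b1 b2; rewrite dot2E.
Qed.

Lemma dot2_invariantP :
  (forall x t, dot2 (x \ox s t) = dot2 (x \ox t)) <->
  (forall x y z, \sw_(y1, y2 <- y) (x ⋅ y1) ⋅ (z ∶ y2) =
                 \sw_(z1, z2 <- z) (x ⋅ z2) ⋅ (y ⋅ z1)).
Proof.
split=> H x; first by move=> y z; rewrite -dot2_s_lin_inv H dot2_lin_inv.
by apply: lin_inv_ext; try (by mlin); move=> b c;
  rewrite dot2_s_lin_inv dot2_lin_inv.
Qed.

(** * The second and third identities *)

(** The image of [a ⊗ b ⊗ c] under the inverse of the map sending
    [x ⊗ y ⊗ z] to [((x ◁ y) ◁ z) ⊗ (y ◁ z) ⊗ z], with the appropriate legs. *)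
Definition triple (a b c : X) : (X ⊗ X) ⊗ X :=
  \sw_(t1, t2 <- (lin_inv nd (b \ox c) : X ⊠ X))
    tassocV X X X (dot2 (a \ox t1) \ox t2).

(** By surjectivity of [G^-1] the elements [b ⊗ c] may be replaced by an
    arbitrary tensor; then the iterated action is undone by its inverse. *)
Lemma triple_ext (W : lmodType k) (f g : (X ⊗ X) ⊗ X -> W) : lin f -> lin g ->
  (forall a b c, f (triple a b c) = g (triple a b c)) -> forall t, f t = g t.
Proof.
move=> fl gl fg.
pose J (h : (X ⊗ X) ⊗ X -> W) a (t : X ⊗ X) : W :=
  \sw_(t1, t2 <- (t : X ⊠ X)) h (tassocV X X X (dot2 (a \ox t1) \ox t2)).
have fgJ a : forall t, J f a t = J g a t.
  apply: lin_inv_ext; rewrite /J; try by mlin.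
  by move=> b c; have := fg a b c; rewrite /triple !(linear_sw (C := X ⊠ X)).
have JE h x t : lin h ->
    \sw_(t1, t2 <- (t : X ⊠ X)) J h (right2 (x \ox t1)) t2 = h (tassocV X X X (x \ox t)).
  move=> hl; rewrite /J.
  rewrite -(@sw_coassoc _ (X ⊠ X) _ t (fun t1 t2 t3 =>
    h (tassocV X X X (dot2 (right2 (x \ox t1) \ox t2) \ox t3)))); try by mlin.
  rewrite -[RHS](sw_counitl (C := X ⊠ X) t
    (F := fun t => h (tassocV X X X (x \ox t)))); last by mlin.
  apply: eq_sw => t1 t2.
  rewrite -(linear_sw (f := fun u => h (tassocV X X X (u \ox t2)))); last by mlin.
  by rewrite dot2_right2 tensZl linearZ (linZ _ _ hl).
apply: tens_ext; try by mlin.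
move=> u z; move: u; apply: tens_ext; try by mlin.
move=> x y; rewrite -tassocVE -!JE //.
by apply: eq_sw => t1 t2; apply: fgJ.
Qed.

(** [(b ⋅ c_1) ∶ (a ⋅ c_2)], [ε(c) (b ∶ a)] and [c ∶ a], as functions of
    [a ⊗ c] with [b] as a parameter. *)
Definition colon_dots (b : X) : {linear X ⊗ X -> X} :=
  induced_colon nd ∘ tflip X X
  ∘ tmap (induced_dot nd) (induced_dot nd ∘ tensl X b)
  ∘ tassocV X X X ∘ tmap (idl X) (tflip X X ∘ comul).
Definition colonl (b : X) : {linear X ⊗ X -> X} :=
  induced_colon nd ∘ tensl X b ∘ projl X X.
Definition colonC : {linear X ⊗ X -> X} := induced_colon nd ∘ tflip X X.

Lemma colon_dotsE b a c :
  colon_dots b (a \ox c) = \sw_(c1, c2 <- c) (b ⋅ c1) ∶ (a ⋅ c2).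
Proof.
transitivity ((induced_colon nd ∘ tflip X X
  ∘ tmap (induced_dot nd) (induced_dot nd ∘ tensl X b)
  ∘ tassocV X X X) (a \ox tflip X X (comul c))).
  by rewrite /colon_dots lcompE tmapE.
rewrite (lin_comul (f := fun t => lcomp _ _ (a \ox tflip X X t))); last by mlin.
by apply: eq_sw => c1 c2; rewrite tflipE 3!lcompE tassocVE tmapE tflipE.
Qed.

Lemma colonlE b a c : colonl b (a \ox c) = (counit c : k) *: (b ∶ a).
Proof. by rewrite /colonl 2!lcompE projlE tenslE tensZr linearZ. Qed.

Lemma colonCE a c : colonC (a \ox c) = c ∶ a.
Proof. by rewrite /colonC lcompE tflipE. Qed.

(** The coproduct of [c ∶ a] reverses the legs of [a], hence the coopposite
    coalgebra. *)
Lemma colonC_morphism : is_coalg_morphism (A := cop_coalg X ⊠ X) colonC.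
Proof.
apply/coalg_morphismP; split; apply: tens_ext; try by mlin.
  move=> a c; rewrite colonCE comul_colon // sw_tensor; last by mlin.
  rewrite sw_cop; last by mlin.
  by apply: eq_sw => a1 a2; apply: eq_sw => c1 c2; rewrite !colonCE.
by move=> a c; rewrite colonCE counit_colon // counit_tens mulrC.
Qed.

(** In [triple a b c] the first two factors are [G^-1 ((a ⋅ c_2) ⊗ (b ⋅ c_1))],
    so [s_lin_inv] computes [s] on them; what is left is a convolution over the
    coalgebra to which [a ⊗ c] belongs. *)
Lemma s12_triple (a b c : X) :
  tmap (idl X) (s_left s) (tassoc X X X (s12 s (triple a b c))) =
  sweedler (C := cop_coalg X ⊠ X) (a \ox c)
    (fun t1 t2 => colon_dots b t1 \ox colonC t2).
Proof.
pose L : {linear (X ⊗ X) ⊗ X -> X ⊗ X} := tmap (idl X) (s_left s) ∘ tassoc X X X.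
pose F a1 a2 c1 c2 c3 c4 : X ⊗ X := ((b ⋅ c1) ∶ (a2 ⋅ c2)) \ox ((a1 ⋅ c3) ▷ c4).
transitivity (\sw_(a1, a2 <- a) \sw_(c1, c' <- c) \sw_(c'', c4 <- c') \sw_(c2, c3 <- c'')
    F a1 a2 c1 c2 c3 c4); last first.
  rewrite (sw_tensor (C := cop_coalg X)); last by mlin.
  rewrite sw_cop; last by mlin.
  apply: eq_sw => a1 a2; rewrite -sw_split4; rewrite /F; try by mlin.
  apply: eq_sw => c1 c2;
    rewrite (colon_dotsE b a2 c1) (colonCE a1 c2) (colonE c2 a1).
  rewrite (linear_sw (f := fun t => t \ox _)); last by mlin.
  apply: eq_sw => c3 c4.
  by rewrite (linear_sw (f := fun t => _ \ox t)) //; mlin.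
rewrite -[LHS]/(L (s12 s (triple a b c))) /triple lin_invE.
pose K (t1 t2 : X ⊗ X) : X ⊗ X := L (s12 s (tassocV X X X (dot2 (a \ox t1) \ox t2))).
transitivity (\sw_(c1, c' <- c) \sw_(t1, t2 <- ((b ⋅ c1) \ox c' : X ⊠ X)) K t1 t2).
  rewrite (linear_sw (C := X ⊠ X) (f := fun t => L (s12 s t))); last by mlin.
  by rewrite (linear_sw
    (f := fun t : X ⊠ X => \sw_(t1, t2 <- t) K t1 t2)) //; rewrite /K; mlin.
rewrite sw_exchange; apply: eq_sw => c1 c'.
rewrite sw_tensor; last by rewrite /K; mlin.
rewrite sw_exchange.
transitivity (\sw_(c'', c4 <- c') \sw_(a1, a2 <- a) \sw_(c2, c3 <- c'')
    F a1 a2 c1 c2 c3 c4); last exact: sw_exchange.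
apply: eq_sw => c'' c4.
transitivity (L (s (lin_inv nd ((a ⋅ c'') \ox (b ⋅ c1))) \ox c4)).
  rewrite lin_invE (linear_sw (f := fun t => L (s t \ox c4))); last by mlin.
  by apply: eq_sw => y1 y2; rewrite /K dot2E tassocVE tmapE.
rewrite s_lin_inv // (linear_sw (f := fun t => L (t \ox c4))); last by mlin.
transitivity (\sw_(u1, u2 <- a ⋅ c'') ((b ⋅ c1) ∶ u2) \ox (u1 ▷ c4)).
  by apply: eq_sw => u1 u2; rewrite /L lcompE tassocE tmapE.
by rewrite sw_dot //; mlin.
Qed.

(** Invariance allows the first factor [dot2 (a ⊗ t_1)] to be replaced by
    [dot2 (a ⊗ s t_1)]; as [s] is a coalgebra morphism, everything then depends
    only on [s t], which [s_lin_inv] computes for [t = G^-1 (b ⊗ c)]. *)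
Lemma s23_triple a b c :
  (forall x t, dot2 (x \ox s t) = dot2 (x \ox t)) ->
  s23 s (triple a b c) =
  \sw_(b1, b2 <- b) \sw_(y1, y2 <- c ∶ b2) \sw_(z1, z2 <- b1)
    tassocV X X X (((a ⋅ z1) ⋅ y1) \ox (y2 \ox z2)).
Proof.
move=> dot2_s.
pose K (t1 t2 : X ⊗ X) := tassocV X X X (dot2 (a \ox t1) \ox t2).
transitivity (\sw_(t1, t2 <- (s (lin_inv nd (b \ox c)) : X ⊠ X)) K t1 t2).
  rewrite (sw_morph (C := X ⊠ X) (D := X ⊠ X) _ hs); last by rewrite /K; mlin.
  rewrite /triple (linear_sw (C := X ⊠ X) (f := s23 s)); last by mlin.
  apply: eq_sw => t1 t2; rewrite /K dot2_s.
  move: t2; apply: tens_ext; try by mlin.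
  by move=> y z; rewrite tassocVE s23E.
rewrite s_lin_inv // (linear_sw
  (f := fun t : X ⊠ X => \sw_(t1, t2 <- t) K t1 t2)); last first.
  by rewrite /K; mlin.
apply: eq_sw => b1 b2; rewrite sw_tensor; last by rewrite /K; mlin.
by apply: eq_sw => y1 y2; apply: eq_sw => z1 z2; rewrite /K dot2E.
Qed.

Section Invariant.
Hypothesis dot2_s : forall x t, dot2 (x \ox s t) = dot2 (x \ox t).

Lemma middle_triple a b c :
  s_left s (tmap (s_right s) (idl X) (s23 s (triple a b c))) = colonl b (a \ox c).
Proof.
rewrite s23_triple // colonlE.
pose f : {linear (X ⊗ X) ⊗ X -> X} := s_left s ∘ tmap (s_right s) (idl X).
rewrite -[LHS]/(f _) (linear_sw (f := f)); last by mlin.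
rewrite -(sw_counitr b (F := fun b => (counit c : k) *: (b ∶ a))); last by mlin.
apply: eq_sw => b1 b2.
rewrite (linear_sw (f := f)); last by mlin.
transitivity (\sw_(z1, z2 <- b1) \sw_(y1, y2 <- c ∶ b2) (((a ⋅ z1) ⋅ y1) ◁ y2) ▷ z2).
  rewrite sw_exchange; apply: eq_sw => y1 y2.
  rewrite (linear_sw (f := f)); last by mlin.
  by apply: eq_sw => z1 z2; rewrite tassocVE /f lcompE tmapE.
rewrite scalerA mulrC -counit_colon (colonE b1 a) scaler_sw; apply: eq_sw => z1 z2.
rewrite -(linear_sw (f := fun t => s_left s (t \ox z2))); last by mlin.
by rewrite dot_right tensZl linearZ.
Qed.

Lemma left_triple a b c :
  s_left s (tmap (idl X) (s_left s) (tassoc X X X (triple a b c))) =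
  \sw_(b1, b2 <- b) (c ∶ b2) ∶ (a ⋅ b1).
Proof.
rewrite -projl_s23 s23_triple //.
pose f : {linear (X ⊗ X) ⊗ X -> X} := s_left s ∘ projl (X ⊠ X) X.
rewrite -[LHS]/(f _) (linear_sw (f := f)); last by mlin.
apply: eq_sw => b1 b2; rewrite (colonE (c ∶ b2)) (linear_sw (f := f));
  last by mlin.
apply: eq_sw => y1 y2; rewrite (linear_sw (f := f)); last by mlin.
rewrite -[RHS](sw_counitr b1 (F := fun z => ((a ⋅ z) ⋅ y1) ▷ y2)); last by mlin.
by apply: eq_sw => z1 z2; rewrite tassocVE /f lcompE projlE linearZ.
Qed.

Lemma colonl_dot_colonC (b a c : X) :
  sweedler (C := cop_coalg X ⊠ X) (a \ox c)
    (fun t1 t2 => colonl b t1 ⋅ colonC t2) =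
  \sw_(a1, a2 <- a) (b ∶ a2) ⋅ (c ∶ a1).
Proof.
rewrite (sw_tensor (C := cop_coalg X)); last by mlin.
rewrite sw_cop; last by mlin.
apply: eq_sw => a1 a2.
rewrite -[RHS](sw_counitl c (F := fun c => (b ∶ a2) ⋅ (c ∶ a1))); last by mlin.
by apply: eq_sw => c1 c2;
  rewrite (colonlE b a2 c1) (colonCE a1 c2) tensZl linearZ.
Qed.

(** Both conditions say that [colon_dots b] and [colonl b] correspond to each
    other under the convolution action through [colonC]: one expresses the
    second by the first using [◁], the other expresses the first by the second
    using [⋅]. *)
Lemma middle_braidP :
  (forall t, s_right s (tmap (idl X) (s_left s) (tassoc X X X (s12 s t))) =
             s_left s (tmap (s_right s) (idl X) (s23 s t))) <->
  (forall x y z, \sw_(y1, y2 <- y) (x ⋅ y1) ∶ (z ⋅ y2) =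
                 \sw_(z1, z2 <- z) (x ∶ z2) ⋅ (y ∶ z1)).
Proof.
have E a b c : s_right s (tmap (idl X) (s_left s) (tassoc X X X (s12 s (triple a b c)))) =
    sweedler (C := cop_coalg X ⊠ X) (a \ox c) (fun t1 t2 => colon_dots b t1 ◁ colonC t2).
  by rewrite s12_triple (linear_sw (C := cop_coalg X ⊠ X)
    (f := s_right s)) //; mlin.
split=> H.
  move=> x y z; rewrite -colon_dotsE -colonl_dot_colonC.
  apply: (conv_cancel (C := cop_coalg X ⊠ X) right_dot colonC_morphism); first by mlin.
  apply: tens_ext; try by mlin.
  by move=> a c; rewrite -E H middle_triple.
apply: triple_ext; try by mlin.
move=> a b c; rewrite E middle_triple; symmetry.
have D : forall t : cop_coalg X ⊠ X, 
   sweedler t (fun t1 t2 => colonl b t1 ⋅ colonC t2) = colon_dots b t.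
  apply: tens_ext; try by mlin.
  by move=> {}a {}c; rewrite colonl_dot_colonC (colon_dotsE b a c) H.
by apply: (conv_cancel (C := cop_coalg X ⊠ X) dot_right colonC_morphism _ D); mlin.
Qed.

(** By the second identity, [s12_triple] is the sum of the
    [G^-1 ((b ∶ a_2) ⊗ (c ∶ a_1))], on which [▷] is by definition [∶]. *)
Lemma left_braidP :
  (forall x y z, \sw_(y1, y2 <- y) (x ⋅ y1) ∶ (z ⋅ y2) =
                 \sw_(z1, z2 <- z) (x ∶ z2) ⋅ (y ∶ z1)) ->
  (forall t, s_left s (tmap (idl X) (s_left s) (tassoc X X X (s12 s t))) =
             s_left s (tmap (idl X) (s_left s) (tassoc X X X t))) <->
  (forall x y z, \sw_(y1, y2 <- y) (x ∶ y1) ∶ (z ∶ y2) =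
                 \sw_(z1, z2 <- z) (x ∶ z2) ∶ (y ⋅ z1)).
Proof.
move=> cyc2.
have D b : forall t : cop_coalg X ⊠ X,
   colon_dots b t = sweedler t (fun t1 t2 => colonl b t1 ⋅ colonC t2).
  apply: tens_ext; try by mlin.
  by move=> a c; rewrite colonl_dot_colonC colon_dotsE cyc2.
have E a b c : s_left s (tmap (idl X) (s_left s) (tassoc X X X (s12 s (triple a b c)))) =
    \sw_(a1, a2 <- a) (c ∶ a1) ∶ (b ∶ a2).
  rewrite s12_triple (linear_sw (C := cop_coalg X ⊠ X) (f := s_left s));
    last by mlin.
  pose F t1 t2 t3 : X := (colonl b t1 ⋅ colonC t2) ▷ colonC t3.
  transitivity (sweedler (C := cop_coalg X ⊠ X) (a \ox c) (fun t1 t2 =>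
     sweedler (C := cop_coalg X ⊠ X) t1 (fun t11 t12 => F t11 t12 t2))).
    apply: eq_sw => t1 t2; rewrite D.
    by rewrite (linear_sw (C := cop_coalg X ⊠ X)
      (f := fun u => s_left s (u \ox _))) //; mlin.
  rewrite (@sw_coassoc _ (cop_coalg X ⊠ X) _ _ F); rewrite /F; try by mlin.
  transitivity (sweedler (C := cop_coalg X ⊠ X) (a \ox c) (fun t1 t2 =>
     colonC t2 ∶ colonl b t1)).
    apply: eq_sw => t1 t2; rewrite (colonE (colonC t2)).
    by rewrite (sw_morph (C := cop_coalg X ⊠ X) _ colonC_morphism) //; mlin.
  rewrite (sw_tensor (C := cop_coalg X)); last by mlin.
  rewrite sw_cop; last by mlin.
  apply: eq_sw => a1 a2.
  rewrite -[RHS](sw_counitl c (F := fun c => (c ∶ a1) ∶ (b ∶ a2))); last by mlin.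
  by apply: eq_sw => c1 c2;
    rewrite (colonlE b a2 c1) (colonCE a1 c2) tensZr linearZ.
split=> H; first by move=> x y z; rewrite -E H left_triple.
by apply: triple_ext; try (by mlin); move=> a b c; rewrite E left_triple.
Qed.

End Invariant.

End Associated.

Theorem theorem4p8 (k : fieldType) (X : coalgType k)
    (s : {linear X ⊗ X -> X ⊗ X}) (hs : is_coalg_morphism s)
    (nd : left_nondegenerate s) :
  set_theoretic_type_solution s <-> is_qcycle_coalgebra (associated_qmagma nd).
Proof.
have [qm lr] := (associated_qmagma_coalgebra hs nd, associated_left_regular nd).
have dot2_sP : (forall x t, dot2 nd (x \ox s t) = dot2 nd (x \ox t)) <->
    (forall t, s_right s (tmap (s_right s) (idl X) t) =
               s_right s (tmap (s_right s) (idl X) (s23 s t))).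
  have right2_tassocV w : right2 s w =
      s_right s (tmap (s_right s) (idl X) (tassocV X X X w)) by [].
  split=> [/(iffRL (right2_invariantP hs nd)) H|H].
    apply: tens_ext; try by mlin.
    move=> u z; move: u; apply: tens_ext; try by mlin.
    by move=> x y; rewrite s23E -right2_tassocV H right2E tmapE.
  apply/(right2_invariantP hs nd) => x; apply: tens_ext; try by mlin.
  by move=> y z; rewrite right2_tassocV -s23E -H tmapE right2E.
split=> [[_ /(iffLR (braid_components hs)) [H3 H2 H1]]|[_ _ C1 C2 C3]].
  have dot2_s := iffRL dot2_sP H3.
  have C2 := iffLR (middle_braidP hs dot2_s) H2.
  split=> //; first exact: (iffLR (dot2_invariantP hs nd) dot2_s).
  exact: (iffLR (left_braidP hs dot2_s C2) H1).
have dot2_s := iffRL (dot2_invariantP hs nd) C1.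
split=> //; apply/(braid_components hs); split.
- exact: (iffLR dot2_sP).
- exact: (iffRL (middle_braidP hs dot2_s)).
- exact: (iffRL (left_braidP hs dot2_s C2)).
Qed.
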